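(* Let $(\gamma_1,\delta_1),(\gamma_2,\delta_2)\in J_\otimes$. The two-faced universal product of states $\mathsf T(\gamma_1,\delta_1;\gamma_2,\delta_2)$ is symmetric if and only if $\gamma_1=\delta_1$ and $\gamma_2=\delta_2$. In other words, among these products the symmetric ones are exactly $\mathsf T(\zeta,\zeta;1,1)$ $(\zeta\in\mathbb T)$, $\mathsf T(0,0;1,1)$, $\mathsf T(1,1;0,0)$ and $\mathsf T(0,0;0,0)$.
   Context: $\mathbb T=\{z\in\mathbb C:|z|=1\}$ and $J_\otimes=\{(\gamma,\delta)\in(\mathbb T\cup\{0\})^2:\gamma=\delta\text{ or }\gamma=0\text{ or }\delta=0\}$. Pre-Hilbert spaces. All pre-Hilbert spaces are complex, with inner product linear in the second argument, and equipped with a distinguished unit vector, always denoted $\Omega$; $\hat H=H\ominus\mathbb C\Omega$. $L_{\mathrm a}(H)$ is the $\ast$-algebra of adjointable linear operators on $H$. $P_\Omega$ is the orthogonal projection onto $\mathbb C\Omega$, $P_{\Omega^\perp}=\mathrm{id}-P_\Omega$. In $H\otimes G$ (algebraic tensor product) the unit vector is $\Omega\otimes\Omega$, also written $\Omega$. The map $T\mapsto T_\gamma$. With respect to $H=\mathbb C\Omega\oplus\hat H$ write $T=\begin{pmatrix}\tau&(t')^*\\ t&\hat T\end{pmatrix}$ with $\tau\in\mathbb C$, $t,t'\in\hat H$, $\hat T\in L_{\mathrm a}(\hat H)$, where $(t')^*$ denotes $h\mapsto\langle t',h\rangle$. Then $T_\gamma:=\begin{pmatrix}|\gamma|\tau&(\gamma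 t')^*\\ \gamma t&|\gamma|\hat T\end{pmatrix}$. Lifts. $\lambda^\gamma_{H,G}(X)=X\otimes P_\Omega+X_\gamma\otimes P_{\Omega^\perp}$ for $X\in L_{\mathrm a}(H)$ and $\rho^\delta_{H,G}(Y)=P_\Omega\otimes Y+P_{\Omega^\perp}\otimes Y_\delta$ for $Y\in L_{\mathrm a}(G)$; these are $\ast$-homomorphisms into $L_{\mathrm a}(H\otimes G)$ for $\gamma,\delta\in\mathbb T\cup\{0\}$. $\ast$-algebras and states. $\ast$-algebras are over $\mathbb C$ and not assumed unital; $\sqcup$ is the non-unital free product (coproduct) of $\ast$-algebras. A linear functional is a state if its unital extension to the unitization is positive. A two-faced $\ast$-algebra is a $\ast$-algebra $A$ with $\ast$-subalgebras $A^{(1)},A^{(2)}$ such that $A=A^{(1)}\sqcup A^{(2)}$ canonically. Associated product of states. Let $\phi,\psi$ be states on two-faced $\ast$-algebras $A,B$. Choose $\ast$-representations $\pi\colon A\to L_{\mathrm a}(H)$, $\sigma\colon B\to L_{\mathrm a}(G)$ with $\phi=\langle\Omega,\pi(\cdot)\Omega\rangle$, $\psi=\langle\Omega,\sigma(\cdot)\Omega\rangle$. Let $\Pi\colon A\sqcup B\to L_{\mathrm a}(H\otimes G)$ be the $\ast$-homomorphism with $\Pi(a)=\lambda^{\gamma_i}_{H,G}(\pi(a))$ for $a\in A^{(i)}$ and $\Pi(b)=\rho^{\delta_i}_{H,G}(\sigma(b))$ for $b\in B^{(i)}$, $i=1,2$. For $\odot=\mathsf T(\gamma_1,\delta_1;\gamma_2,\delta_2)$,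 $\phi\odot\psi$ is the state $c\mapsto\langle\Omega,\Pi(c)\Omega\rangle$ on $A\sqcup B$; it does not depend on the choice of $\pi,\sigma$. A product $\odot$ of states is symmetric if $\phi\odot\psi=(\psi\odot\phi)\circ\Theta_{A,B}$ for all states $\phi$ on $A$ and $\psi$ on $B$ ($A,B$ two-faced $\ast$-algebras), where $\Theta_{A,B}\colon A\sqcup B\to B\sqcup A$ is the natural identification. *)

(* Defs.v *)
From HB Require Import structures.
From mathcomp Require Import all_boot all_order all_algebra.
From mathcomp Require Import complex ring.
From mathcomp Require Import boolp classical_sets reals.

Set Implicit Arguments.
Unset Strict Implicit.
Unset Printing Implicit Defensive.

Import Order.TTheory GRing.Theory Num.Theory.

Local Open Scope ring_scope.
Local Open Scope quotient_scope.
Local Open Scope classical_set_scope.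

Reserved Notation "x ⋅ y" (at level 40, left associativity).
Reserved Notation "x ^†" (at level 1, format "x ^†").
Reserved Notation "⟨ x , y ⟩" (at level 0, format "⟨ x ,  y ⟩").
Reserved Notation "'Ω'".

(* Not necessarily unital *-algebras. *)
HB.mixin Record isStarAlgebra (C : numClosedFieldType) A
    of GRing.Lmodule C A := {
  smul : A -> A -> A;
  star : A -> A;
  smulA : forall x y z, smul x (smul y z) = smul (smul x y) z;
  smulPl : forall a x y z, smul (a *: x + y) z = a *: smul x z + smul y z;
  smulPr : forall a x y z, smul x (a *: y + z) = a *: smul x y + smul x z;
  starP : forall a x y, star (a *: x + y) = a^* *: star x + star y;
  starM : forall x y, star (smul x y) = smul (star y) (star x);
  starK : forall x, star (star x) = x
}.

#[short(type="starAlgType")]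
HB.structure Definition StarAlgebra (C : numClosedFieldType) :=
  { A of GRing.Lmodule C A & isStarAlgebra C A }.

Notation "x ⋅ y" := (smul x y) : ring_scope.
Notation "x ^†" := (star x) : ring_scope.

(* Pre-Hilbert spaces with a distinguished unit vector; the inner product is
   linear in its second argument. *)
HB.mixin Record isPreHilbert (C : numClosedFieldType) H
    of GRing.Lmodule C H := {
  inner : H -> H -> C;
  vacuum : H;
  innerPr : forall a x y z, inner x (a *: y + z) = a * inner x y + inner x z;
  innerC : forall x y, inner x y = (inner y x)^*;
  inner_ge0 : forall x, 0 <= inner x x;
  inner_eq0 : forall x, inner x x = 0 -> x = 0;
  inner_vacuum : inner vacuum vacuum = 1
}.

#[short(type="preHilbertType")]
HB.structure Definition PreHilbert (C : numClosedFieldType) :=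
  { H of GRing.Lmodule C H & isPreHilbert C H }.

Notation "⟨ x , y ⟩" := (inner x y) : ring_scope.
Notation "'Ω'" := vacuum : ring_scope.

Section StarHom.
Context {C : numClosedFieldType}.

Section Theory.
Variable A : starAlgType C.
Implicit Types x y z : A.

Lemma smulDl x y z : (x + y) ⋅ z = x ⋅ z + y ⋅ z.
Proof. by rewrite -{1}[x]scale1r smulPl scale1r. Qed.
Lemma smulDr x y z : z ⋅ (x + y) = z ⋅ x + z ⋅ y.
Proof. by rewrite -{1}[x]scale1r smulPr scale1r. Qed.
Lemma smul0l x : 0 ⋅ x = 0.
Proof. by apply: (addrI (0 ⋅ x)); rewrite -smulDl !addr0. Qed.
Lemma smul0r x : x ⋅ 0 = 0.
Proof. by apply: (addrI (x ⋅ 0)); rewrite -smulDr !addr0. Qed.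
Lemma smulZl a x y : (a *: x) ⋅ y = a *: (x ⋅ y).
Proof. by rewrite -[a *: x]addr0 smulPl smul0l addr0. Qed.
Lemma smulZr a x y : x ⋅ (a *: y) = a *: (x ⋅ y).
Proof. by rewrite -[a *: y]addr0 smulPr smul0r addr0. Qed.
Lemma starD x y : (x + y)^† = x^† + y^†.
Proof. by rewrite -{1}[x]scale1r starP conjC1 scale1r. Qed.
Lemma star0 : (0 : A)^† = 0.
Proof. by apply: (addrI ((0 : A)^†)); rewrite -starD !addr0. Qed.
Lemma starZ a x : (a *: x)^† = a^* *: x^†.
Proof. by rewrite -[a *: x]addr0 starP star0 addr0. Qed.
End Theory.

Definition star_subalgebra (A : starAlgType C) (S : set A) : Prop :=
  [/\ S 0, forall a x y, S x -> S y -> S (a *: x + y),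
      forall x y, S x -> S y -> S (x ⋅ y) & forall x, S x -> S x^†].

Definition star_hom_on (A B : starAlgType C) (S : set A) (f : A -> B) : Prop :=
  [/\ forall a x y, S x -> S y -> f (a *: x + y) = a *: f x + f y,
      forall x y, S x -> S y -> f (x ⋅ y) = f x ⋅ f y &
      forall x, S x -> f x^† = (f x)^†].

Definition star_hom (A B : starAlgType C) (f : A -> B) : Prop :=
  star_hom_on setT f.

Section StarHomTheory.
Variables (A B : starAlgType C) (f : A -> B).
Hypothesis fh : star_hom f.
Lemma homP a x y : f (a *: x + y) = a *: f x + f y.
Proof. by case: fh => h _ _; apply: h. Qed.
Lemma homM x y : f (x ⋅ y) = f x ⋅ f y.
Proof. by case: fh => _ h _; apply: h. Qed.
Lemma homS x : f x^† = (f x)^†.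
Proof. by case: fh => _ _ h; apply: h. Qed.
Lemma homD x y : f (x + y) = f x + f y.
Proof. by rewrite -{1}[x]scale1r homP scale1r. Qed.
Lemma hom0 : f 0 = 0.
Proof. by apply: (addrI (f 0)); rewrite -homD !addr0. Qed.
Lemma homZ a x : f (a *: x) = a *: f x.
Proof. by rewrite -[a *: x]addr0 homP hom0 addr0. Qed.
End StarHomTheory.

Lemma star_hom_comp (A B D : starAlgType C) (f : A -> B) (g : B -> D) :
  star_hom f -> star_hom g -> star_hom (g \o f).
Proof.
move=> fh gh; split=> * /=; first by rewrite homP // homP.
  by rewrite !homM.
by rewrite !homS.
Qed.

End StarHom.

(* The coproduct A ⊔ B of *-algebras: *-algebraic expressions in elements of A
   and B, two expressions being identified when they agree under every pair of
   *-homomorphisms from A and B to a common *-algebra. *)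
Inductive fpterm (C A B : Type) :=
  | FInl of A
  | FInr of B
  | FZero
  | FAdd of fpterm C A B & fpterm C A B
  | FScale of C & fpterm C A B
  | FMul of fpterm C A B & fpterm C A B
  | FStar of fpterm C A B.
Arguments FInl {C A B}. Arguments FInr {C A B}. Arguments FZero {C A B}.

HB.instance Definition _ C A B := gen_eqMixin (fpterm C A B).
HB.instance Definition _ C A B := gen_choiceMixin (fpterm C A B).

Section FreeProduct.
Variables (C : numClosedFieldType) (A B : starAlgType C).
Local Notation term := (fpterm C A B).

Fixpoint fpeval (D : starAlgType C) (f : A -> D) (g : B -> D) (t : term) : D :=
  match t with
  | FInl a => f a
  | FInr b => g b
  | FZero => 0
  | FAdd t u => fpeval f g t + fpeval f g u
  | FScale c t => c *: fpeval f g t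
  | FMul t u => fpeval f g t ⋅ fpeval f g u
  | FStar t => (fpeval f g t)^†
  end.

Definition fpequiv (t u : term) : Prop :=
  forall (D : starAlgType C) (f : A -> D) (g : B -> D),
    star_hom f -> star_hom g -> fpeval f g t = fpeval f g u.

Definition fprel (t u : term) : bool := `[< fpequiv t u >].

Fact fprel_refl : reflexive fprel.
Proof. by move=> t; apply/asboolP. Qed.
Fact fprel_sym : symmetric fprel.
Proof.
by move=> t u; apply/asboolP/asboolP => h D f g fh gh; rewrite h.
Qed.
Fact fprel_trans : transitive fprel.
Proof.
move=> t u v /asboolP h1 /asboolP h2; apply/asboolP => D f g fh gh.
by rewrite h1 // h2.
Qed.

Canonical fprel_equiv := EquivRel fprel fprel_refl fprel_sym fprel_trans.
Definition fprod := {eq_quot fprel}.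
HB.instance Definition _ := Choice.on fprod.
HB.instance Definition _ := EqQuotient.on fprod.

Definition fp_inl (a : A) : fprod := \pi_fprod (FInl a).
Definition fp_inr (b : B) : fprod := \pi_fprod (FInr b).

Definition fp_lift (D : starAlgType C) (f : A -> D) (g : B -> D) (x : fprod) : D :=
  fpeval f g (repr x).

Lemma fp_liftE (D : starAlgType C) (f : A -> D) (g : B -> D) t :
  star_hom f -> star_hom g -> fp_lift f g (\pi_fprod t) = fpeval f g t.
Proof.
move=> fh gh; rewrite /fp_lift.
have /eqmodP/asboolP : repr (\pi_fprod t) = t %[mod fprod] by rewrite reprK.
exact.
Qed.

Lemma fp_ext (x y : fprod) :
  (forall (D : starAlgType C) (f : A -> D) (g : B -> D),
     star_hom f -> star_hom g -> fp_lift f g x = fp_lift f g y) -> x = y.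
Proof.
move=> h; rewrite -[x]reprK -[y]reprK; apply/eqmodP/asboolP => D f g fh gh.
exact: h.
Qed.

Definition fp_zero : fprod := \pi_fprod FZero.
Definition fp_add (x y : fprod) : fprod := \pi_fprod (FAdd (repr x) (repr y)).
Definition fp_scale c (x : fprod) : fprod := \pi_fprod (FScale c (repr x)).
Definition fp_opp (x : fprod) : fprod := fp_scale (-1) x.
Definition fp_mul (x y : fprod) : fprod := \pi_fprod (FMul (repr x) (repr y)).
Definition fp_star (x : fprod) : fprod := \pi_fprod (FStar (repr x)).

Section LiftOps.
Variables (D : starAlgType C) (f : A -> D) (g : B -> D).
Hypotheses (fh : star_hom f) (gh : star_hom g).
Fact fp_lift_zero : fp_lift f g fp_zero = 0.
Proof. by rewrite fp_liftE. Qed.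
Fact fp_lift_add x y :
  fp_lift f g (fp_add x y) = fp_lift f g x + fp_lift f g y.
Proof. by rewrite fp_liftE. Qed.
Fact fp_lift_scale c x : fp_lift f g (fp_scale c x) = c *: fp_lift f g x.
Proof. by rewrite fp_liftE. Qed.
Fact fp_lift_mul x y :
  fp_lift f g (fp_mul x y) = fp_lift f g x ⋅ fp_lift f g y.
Proof. by rewrite fp_liftE. Qed.
Fact fp_lift_star x : fp_lift f g (fp_star x) = (fp_lift f g x)^†.
Proof. by rewrite fp_liftE. Qed.
End LiftOps.
Let liftE := (fp_lift_zero, fp_lift_add, fp_lift_scale, fp_lift_mul,
  fp_lift_star).

Fact fp_addA : associative fp_add.
Proof. by move=> x y z; apply: fp_ext => D f g fh gh; rewrite !liftE // addrA. Qed.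
Fact fp_addC : commutative fp_add.
Proof. by move=> x y; apply: fp_ext => D f g fh gh; rewrite !liftE // addrC. Qed.
Fact fp_add0 : left_id fp_zero fp_add.
Proof. by move=> x; apply: fp_ext => D f g fh gh; rewrite !liftE // add0r. Qed.
Fact fp_addN : left_inverse fp_zero fp_opp fp_add.
Proof.
move=> x; apply: fp_ext => D f g fh gh.
by rewrite !liftE // scaleN1r addNr.
Qed.
HB.instance Definition _ :=
  GRing.isZmodule.Build fprod fp_addA fp_addC fp_add0 fp_addN.

Fact fp_scaleA a b x : fp_scale a (fp_scale b x) = fp_scale (a * b) x.
Proof. by apply: fp_ext => D f g fh gh; rewrite !liftE // scalerA. Qed.
Fact fp_scale1 : left_id 1 fp_scale.
Proof. by move=> x; apply: fp_ext => D f g fh gh; rewrite !liftE // scale1r. Qed.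
Fact fp_scaleDr : right_distributive fp_scale +%R.
Proof.
move=> a x y; apply: (@fp_ext _ (fp_add _ _)) => D f g fh gh.
by rewrite !liftE // scalerDr.
Qed.
Fact fp_scaleDl x : {morph fp_scale^~ x : a b / a + b}.
Proof.
move=> a b; apply: (@fp_ext _ (fp_add _ _)) => D f g fh gh.
by rewrite !liftE // scalerDl.
Qed.
HB.instance Definition _ := GRing.Zmodule_isLmodule.Build C fprod
  fp_scaleA fp_scale1 fp_scaleDr fp_scaleDl.

Lemma fp_liftP (D : starAlgType C) (f : A -> D) (g : B -> D) a x y :
  star_hom f -> star_hom g ->
  fp_lift f g (a *: x + y) = a *: fp_lift f g x + fp_lift f g y.
Proof.
move=> fh gh.
by rewrite (fp_lift_add fh gh (fp_scale a x)) fp_lift_scale.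
Qed.

Let ext := (fp_liftP, fp_lift_mul, fp_lift_star).
Fact fp_mulA x y z : fp_mul x (fp_mul y z) = fp_mul (fp_mul x y) z.
Proof. by apply: fp_ext => D f g fh gh; rewrite !ext // smulA. Qed.
Fact fp_mulPl a x y z : fp_mul (a *: x + y) z = a *: fp_mul x z + fp_mul y z.
Proof. by apply: fp_ext => D f g fh gh; rewrite !ext // smulPl. Qed.
Fact fp_mulPr a x y z : fp_mul x (a *: y + z) = a *: fp_mul x y + fp_mul x z.
Proof. by apply: fp_ext => D f g fh gh; rewrite !ext // smulPr. Qed.
Fact fp_starP a x y : fp_star (a *: x + y) = a^* *: fp_star x + fp_star y.
Proof. by apply: fp_ext => D f g fh gh; rewrite !ext // starP. Qed.
Fact fp_starM x y : fp_star (fp_mul x y) = fp_mul (fp_star y) (fp_star x).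
Proof. by apply: fp_ext => D f g fh gh; rewrite !ext // starM. Qed.
Fact fp_starK x : fp_star (fp_star x) = x.
Proof. by apply: fp_ext => D f g fh gh; rewrite !ext // starK. Qed.
HB.instance Definition _ := isStarAlgebra.Build C fprod
  fp_mulA fp_mulPl fp_mulPr fp_starP fp_starM fp_starK.

Lemma fp_inl_hom : star_hom fp_inl.
Proof.
split=> [a x y _ _|x y _ _|x _]; apply: fp_ext => D f g fh gh;
  rewrite !ext // !fp_liftE //=.
- exact: homP.
- exact: homM.
- exact: homS.
Qed.

Lemma fp_inr_hom : star_hom fp_inr.
Proof.
split=> [a x y _ _|x y _ _|x _]; apply: fp_ext => D f g fh gh;
  rewrite !ext // !fp_liftE //=.
- exact: homP.
- exact: homM.
- exact: homS.
Qed.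

Section Lift.
Variables (D : starAlgType C) (f : A -> D) (g : B -> D).
Hypotheses (fh : star_hom f) (gh : star_hom g).

Lemma fp_lift_hom : star_hom (fp_lift f g).
Proof.
split=> *; first exact: fp_liftP.
  exact: fp_lift_mul.
exact: fp_lift_star.
Qed.

Lemma fp_lift_inl a : fp_lift f g (fp_inl a) = f a.
Proof. by rewrite fp_liftE. Qed.

Lemma fp_lift_inr b : fp_lift f g (fp_inr b) = g b.
Proof. by rewrite fp_liftE. Qed.

Lemma fp_lift_unique h : star_hom h ->
  (forall a, h (fp_inl a) = f a) -> (forall b, h (fp_inr b) = g b) ->
  h =1 fp_lift f g.
Proof.
move=> hh hl hr x; rewrite -[x]reprK fp_liftE //.
elim: (repr x) => [a|b||t IHt u IHu|c t IH|t IHt u IHu|t IH] /=.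
- exact: hl.
- exact: hr.
- by rewrite -[\pi_ _ _]/(0 : fprod) hom0.
- rewrite -IHt -IHu -homD //; congr h.
  by apply: (@fp_ext _ (fp_add _ _)) => E k l kh lh; rewrite liftE // !fp_liftE.
- rewrite -IH -homZ //; congr h.
  by apply: (@fp_ext _ (fp_scale _ _)) => E k l kh lh; rewrite liftE // !fp_liftE.
- rewrite -IHt -IHu -homM //; congr h.
  by apply: (@fp_ext _ (fp_mul _ _)) => E k l kh lh; rewrite liftE // !fp_liftE.
- rewrite -IH -homS //; congr h.
  by apply: (@fp_ext _ (fp_star _)) => E k l kh lh; rewrite liftE // !fp_liftE.
Qed.
End Lift.

End FreeProduct.

Section PreHilbertTheory.
Variables (C : numClosedFieldType) (H : preHilbertType C).
Implicit Types x y z : H.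

Lemma innerDr x y z : ⟨x, y + z⟩ = ⟨x, y⟩ + ⟨x, z⟩.
Proof. by rewrite -{1}[y]scale1r innerPr mul1r. Qed.
Lemma inner0r x : ⟨x, 0⟩ = 0.
Proof. by apply: (addrI ⟨x, 0⟩); rewrite -innerDr !addr0. Qed.
Lemma innerZr a x y : ⟨x, a *: y⟩ = a * ⟨x, y⟩.
Proof. by rewrite -[a *: y]addr0 innerPr inner0r addr0. Qed.
Lemma innerNr x y : ⟨x, - y⟩ = - ⟨x, y⟩.
Proof. by rewrite -scaleN1r innerZr mulN1r. Qed.
Lemma innerDl x y z : ⟨x + y, z⟩ = ⟨x, z⟩ + ⟨y, z⟩.
Proof. by rewrite innerC innerDr rmorphD /= -!innerC. Qed.
Lemma innerZl a x y : ⟨a *: x, y⟩ = a^* * ⟨x, y⟩.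
Proof. by rewrite innerC innerZr rmorphM /= -innerC. Qed.
Lemma inner0l x : ⟨0, x⟩ = 0.
Proof. by rewrite innerC inner0r conjC0. Qed.
Lemma innerNl x y : ⟨- x, y⟩ = - ⟨x, y⟩.
Proof. by rewrite innerC innerNr rmorphN /= -innerC. Qed.
Lemma innerBr x y z : ⟨x, y - z⟩ = ⟨x, y⟩ - ⟨x, z⟩.
Proof. by rewrite innerDr innerNr. Qed.
Lemma innerBl x y z : ⟨x - y, z⟩ = ⟨x, z⟩ - ⟨y, z⟩.
Proof. by rewrite innerDl innerNl. Qed.
Lemma inner_sumr I (s : seq I) (F : I -> H) x :
  ⟨x, \sum_(i <- s) F i⟩ = \sum_(i <- s) ⟨x, F i⟩.
Proof.
by elim: s => [|i s IH]; rewrite ?big_nil ?inner0r // !big_cons innerDr IH.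
Qed.
Lemma inner_suml I (s : seq I) (F : I -> H) x :
  ⟨\sum_(i <- s) F i, x⟩ = \sum_(i <- s) ⟨F i, x⟩.
Proof.
by elim: s => [|i s IH]; rewrite ?big_nil ?inner0l // !big_cons innerDl IH.
Qed.
Lemma inner_extr x y : (forall z, ⟨z, x⟩ = ⟨z, y⟩) -> x = y.
Proof.
move=> h; apply/eqP; rewrite -subr_eq0; apply/eqP/inner_eq0.
by rewrite innerBr h subrr.
Qed.
Lemma inner_extl x y : (forall z, ⟨x, z⟩ = ⟨y, z⟩) -> x = y.
Proof. by move=> h; apply: inner_extr => z; rewrite innerC h -innerC. Qed.
End PreHilbertTheory.

(* The *-algebra L_a(H). An operator with an adjoint is automatically linear,
   and the adjoint is unique. *)
Record adjop (C : numClosedFieldType) (H : preHilbertType C) := AdjOp {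
  opfun :> H -> H;
  opadj : H -> H;
  opadjP : forall x y, ⟨opfun x, y⟩ = ⟨x, opadj y⟩
}.
HB.instance Definition _ C H := gen_eqMixin (@adjop C H).
HB.instance Definition _ C H := gen_choiceMixin (@adjop C H).

Section Adjop.
Variables (C : numClosedFieldType) (H : preHilbertType C).
Implicit Types (X Y Z : adjop H) (x y z : H).

Lemma adjop_ext X Y : X =1 Y -> X = Y.
Proof.
case: X Y => [X X' XP] [Y Y' YP] /= /funext e; subst Y.
have /funext e : X' =1 Y' by move=> y; apply: inner_extr => z; rewrite -XP -YP.
by subst Y'; congr AdjOp; apply: Prop_irrelevance.
Qed.

Lemma opadjPl X x y : ⟨opadj X x, y⟩ = ⟨x, X y⟩.
Proof. by rewrite innerC -opadjP -innerC. Qed.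
Lemma opP X a x y : X (a *: x + y) = a *: X x + X y.
Proof. by apply: inner_extr => z; rewrite -opadjPl !innerPr !opadjPl. Qed.
Lemma opD X x y : X (x + y) = X x + X y.
Proof. by apply: inner_extr => z; rewrite -opadjPl !innerDr !opadjPl. Qed.
Lemma opZ X a x : X (a *: x) = a *: X x.
Proof. by apply: inner_extr => z; rewrite -opadjPl !innerZr !opadjPl. Qed.
Lemma op0 X : X 0 = 0.
Proof. by apply: inner_extr => z; rewrite -opadjPl !inner0r. Qed.
Lemma op_sum X I (s : seq I) (F : I -> H) :
  X (\sum_(i <- s) F i) = \sum_(i <- s) X (F i).
Proof.
by elim: s => [|i s IH]; rewrite ?big_nil ?op0 // !big_cons opD IH.
Qed.

Definition op_id : adjop H := @AdjOp C H id id (fun _ _ => erefl).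

Program Definition op_zero : adjop H := @AdjOp C H (fun _ => 0) (fun _ => 0) _.
Next Obligation. by rewrite inner0l inner0r. Qed.
Program Definition op_add X Y : adjop H :=
  @AdjOp C H (fun x => X x + Y x) (fun x => opadj X x + opadj Y x) _.
Next Obligation. by rewrite innerDl innerDr !opadjP. Qed.
Program Definition op_opp X : adjop H :=
  @AdjOp C H (fun x => - X x) (fun x => - opadj X x) _.
Next Obligation. by rewrite innerNl innerNr !opadjP. Qed.
Program Definition op_scale (a : C) X : adjop H :=
  @AdjOp C H (fun x => a *: X x) (fun x => a^* *: opadj X x) _.
Next Obligation. by rewrite innerZl innerZr !opadjP. Qed.
Program Definition op_mul X Y : adjop H :=
  @AdjOp C H (fun x => X (Y x)) (fun x => opadj Y (opadj X x)) _.
Next Obligation. by rewrite !opadjP. Qed.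
Program Definition op_star X : adjop H := @AdjOp C H (opadj X) X _.
Next Obligation. exact: opadjPl. Qed.

Fact op_addA : associative op_add.
Proof. by move=> X Y Z; apply: adjop_ext => x /=; rewrite addrA. Qed.
Fact op_addC : commutative op_add.
Proof. by move=> X Y; apply: adjop_ext => x /=; rewrite addrC. Qed.
Fact op_add0 : left_id op_zero op_add.
Proof. by move=> X; apply: adjop_ext => x /=; rewrite add0r. Qed.
Fact op_addN : left_inverse op_zero op_opp op_add.
Proof. by move=> X; apply: adjop_ext => x /=; rewrite addNr. Qed.
HB.instance Definition _ :=
  GRing.isZmodule.Build (adjop H) op_addA op_addC op_add0 op_addN.

Fact op_scaleA a b X : op_scale a (op_scale b X) = op_scale (a * b) X.
Proof. by apply: adjop_ext => x /=; rewrite scalerA. Qed.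
Fact op_scale1 : left_id 1 op_scale.
Proof. by move=> X; apply: adjop_ext => x /=; rewrite scale1r. Qed.
Fact op_scaleDr : right_distributive op_scale +%R.
Proof. by move=> a X Y; apply: adjop_ext => x /=; rewrite scalerDr. Qed.
Fact op_scaleDl X : {morph op_scale^~ X : a b / a + b}.
Proof. by move=> a b; apply: adjop_ext => x /=; rewrite scalerDl. Qed.
HB.instance Definition _ := GRing.Zmodule_isLmodule.Build C (adjop H)
  op_scaleA op_scale1 op_scaleDr op_scaleDl.

Fact op_mulA X Y Z : op_mul X (op_mul Y Z) = op_mul (op_mul X Y) Z.
Proof. exact: adjop_ext. Qed.
Fact op_mulPl a X Y Z : op_mul (a *: X + Y) Z = a *: op_mul X Z + op_mul Y Z.
Proof. exact: adjop_ext. Qed.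
Fact op_mulPr a X Y Z : op_mul X (a *: Y + Z) = a *: op_mul X Y + op_mul X Z.
Proof. by apply: adjop_ext => x /=; rewrite opP. Qed.
Fact op_starP a X Y : op_star (a *: X + Y) = a^* *: op_star X + op_star Y.
Proof. exact: adjop_ext. Qed.
Fact op_starM X Y : op_star (op_mul X Y) = op_mul (op_star Y) (op_star X).
Proof. exact: adjop_ext. Qed.
Fact op_starK X : op_star (op_star X) = X.
Proof. exact: adjop_ext. Qed.
HB.instance Definition _ := isStarAlgebra.Build C (adjop H)
  op_mulA op_mulPl op_mulPr op_starP op_starM op_starK.

Program Definition proj_vac : adjop H :=
  @AdjOp C H (fun x => ⟨Ω, x⟩ *: Ω) (fun x => ⟨Ω, x⟩ *: Ω) _.
Next Obligation. by rewrite innerZl innerZr -innerC mulrC. Qed.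
Program Definition proj_perp : adjop H :=
  @AdjOp C H (fun x => x - ⟨Ω, x⟩ *: Ω) (fun x => x - ⟨Ω, x⟩ *: Ω) _.
Next Obligation.
by rewrite innerBl innerBr innerZl innerZr -innerC mulrC.
Qed.

(* T_γ, with τ = ⟨Ω, T Ω⟩, t = P_Ω⊥ T Ω, t' = P_Ω⊥ T* Ω and P_Ω⊥ T P_Ω⊥ in place
   of the blocks of T *)
Definition twist_fun (γ : C) (T : adjop H) (h : H) : H :=
  let τ := ⟨Ω, T Ω⟩ in
  let t := proj_perp (T Ω) in
  let t' := proj_perp (opadj T Ω) in
  (`|γ| * τ * ⟨Ω, h⟩ + ⟨γ *: t', proj_perp h⟩) *: Ω
  + (⟨Ω, h⟩ *: (γ *: t) + `|γ| *: proj_perp (T (proj_perp h))).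

Lemma proj_perpE x : proj_perp x = x - ⟨Ω, x⟩ *: Ω. Proof. by []. Qed.
Lemma proj_perp_adj x y : ⟨proj_perp x, y⟩ = ⟨x, proj_perp y⟩.
Proof. by rewrite opadjP. Qed.
Lemma inner_vac_perp x : ⟨Ω, proj_perp x⟩ = 0.
Proof. by rewrite proj_perpE innerBr innerZr inner_vacuum mulr1 subrr. Qed.
Lemma proj_perp_vac : proj_perp Ω = 0.
Proof. by rewrite proj_perpE inner_vacuum scale1r subrr. Qed.
Lemma proj_perpK x : proj_perp (proj_perp x) = proj_perp x.
Proof. by rewrite [LHS]proj_perpE inner_vac_perp scale0r subr0. Qed.
Lemma conj_norm (a : C) : `|a|^* = `|a|.
Proof. by apply/CrealP/normr_real. Qed.

Fact twist_adj γ T x y :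
  ⟨twist_fun γ T x, y⟩ = ⟨x, twist_fun γ (op_star T) y⟩.
Proof.
rewrite /twist_fun -[opfun (op_star T)]/(opadj T) -[opadj (op_star T)]/(opfun T).
have e : ⟨proj_perp (T (proj_perp x)), y⟩
       = ⟨x, proj_perp (opadj T (proj_perp y))⟩.
  by rewrite proj_perp_adj opadjP -proj_perp_adj.
have e1 z w : ⟨proj_perp z, w⟩ = ⟨proj_perp z, proj_perp w⟩.
  by rewrite -[in LHS]proj_perpK proj_perp_adj.
have e2 z w : ⟨w, proj_perp z⟩ = ⟨proj_perp w, proj_perp z⟩.
  by rewrite innerC e1 -innerC.
have e3 : ⟨Ω, opadj T Ω⟩ = ⟨Ω, T Ω⟩^* by rewrite -opadjP -innerC.
move: (e1 (T Ω) y) (e2 (opadj T Ω) x) e.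
move: (proj_perp (T (proj_perp x))) (proj_perp (opadj T (proj_perp y))) => s s'.
move: (proj_perp (T Ω)) (proj_perp (opadj T Ω)) => t t'.
move: (proj_perp x) (proj_perp y) => x' y'.
move=> h1 h2 h3.
rewrite !innerDl !innerDr !innerZl !innerZr !rmorphD !rmorphM.
rewrite conj_norm -!innerC /= ?conjCK e3 h1 h2 h3 conj_norm.
by rewrite -(innerC x) -(innerC x'); ring.
Qed.

Definition twist (γ : C) (T : adjop H) : adjop H :=
  AdjOp (twist_adj γ T).

Lemma twistE (T : adjop H) (γ : C) :
  twist γ T = `|γ| *: (proj_vac ⋅ T ⋅ proj_vac + proj_perp ⋅ T ⋅ proj_perp)
    + (γ *: (proj_perp ⋅ T ⋅ proj_vac) + γ^* *: (proj_vac ⋅ T ⋅ proj_perp)).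
Proof.
apply: adjop_ext => x; rewrite -[LHS]/(twist_fun γ T x) /twist_fun.
have -> : ⟨γ *: proj_perp (opadj T Ω), proj_perp x⟩
        = γ^* * ⟨Ω, T (proj_perp x)⟩.
  by rewrite innerZl proj_perp_adj proj_perpK opadjPl.
rewrite -[RHS]/(`|γ| *: (⟨Ω, T (⟨Ω, x⟩ *: Ω)⟩ *: Ω
    + proj_perp (T (proj_perp x)))
  + (γ *: proj_perp (T (⟨Ω, x⟩ *: Ω))
    + γ^* *: (⟨Ω, T (proj_perp x)⟩ *: Ω))).
rewrite !opZ innerZr !scalerDr !scalerDl !scalerA.
rewrite [in RHS]mulrA [`|γ| * _ * ⟨Ω, T Ω⟩]mulrAC.
rewrite [⟨Ω, x⟩ * γ]mulrC.
by rewrite [LHS]addrACA [RHS]addrACA; congr (_ + _); rewrite addrC.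
Qed.

Definition op_phase (γ : C) : adjop H := proj_vac + γ *: proj_perp.

Lemma twist_phase γ T : `|γ| = 1 ->
  twist γ T = op_phase γ ⋅ T ⋅ (op_phase γ)^†.
Proof.
move=> g1; rewrite twistE g1 scale1r /op_phase.
have sP : proj_vac^† = proj_vac by apply: adjop_ext.
have sQ : proj_perp^† = proj_perp by apply: adjop_ext.
have gg : γ * γ^* = 1 by rewrite -normCK g1 expr1n.
rewrite starD starZ sP sQ !smulDl !smulDr !smulZl !smulZr scalerA.
have gg' : γ^* * γ = 1 by rewrite mulrC.
rewrite ?gg ?gg' scale1r [LHS]addrACA [RHS]addrACA.
by congr (_ + _); rewrite addrC.
Qed.

Lemma op_phaseK γ : `|γ| = 1 -> (op_phase γ)^† ⋅ op_phase γ = op_id.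
Proof.
move=> g1; apply: adjop_ext => x.
apply: inner_extr => z.
rewrite -[LHS](opadjP (op_phase γ) z (op_phase γ x)).
rewrite -[op_phase γ z]/(⟨Ω, z⟩ *: Ω + γ *: proj_perp z).
rewrite -[op_phase γ x]/(⟨Ω, x⟩ *: Ω + γ *: proj_perp x).
rewrite innerDl !innerDr !innerZl !innerZr inner_vacuum inner_vac_perp.
rewrite [⟨proj_perp z, Ω⟩]innerC inner_vac_perp conjC0 proj_perp_adj proj_perpK.
rewrite [⟨z, proj_perp x⟩]innerBr innerZr -innerC.
rewrite !mulr0 addr0 add0r !mulr1 [_ * (γ * _)]mulrCA mulrA -normCK g1.
by rewrite expr1n mul1r; ring.
Qed.

Lemma twist0 T : twist 0 T = 0.
Proof. by rewrite twistE normr0 conjC0 !scale0r !addr0. Qed.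

Lemma twist_hom γ : `|γ| = 1 \/ γ = 0 -> star_hom (twist γ).
Proof.
case=> [g1|->]; last first.
  split=> *; rewrite !twist0 ?scaler0 ?addr0 ?smul0l ?star0 //.
split=> [a X Y _ _|X Y _ _|X _]; rewrite !twist_phase //.
- by rewrite smulPr smulPl.
- rewrite !smulA -[_ ⋅ X ⋅ _ ⋅ op_phase γ]smulA op_phaseK //.
  by congr (_ ⋅ _ ⋅ _); apply: adjop_ext.
- by rewrite !starM starK smulA.
Qed.

Lemma op_idl X : op_id ⋅ X = X. Proof. exact: adjop_ext. Qed.
Lemma op_idr X : X ⋅ op_id = X. Proof. exact: adjop_ext. Qed.
End Adjop.

(* The algebraic tensor product U ⊗ V: finite formal sums of pairs (u, v), two
   sums being identified when every bilinear map takes the same value on them. *)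
Definition bilinear_map (C : numClosedFieldType) (U V W : lmodType C)
    (β : U -> V -> W) : Prop :=
  (forall a u u' v, β (a *: u + u') v = a *: β u v + β u' v) /\
  (forall a u v v', β u (a *: v + v') = a *: β u v + β u v').

Section Tensor.
Variables (C : numClosedFieldType) (U V : lmodType C).
Local Notation fsum := (seq (U * V)).

Definition tens_eval (W : lmodType C) (β : U -> V -> W) (s : fsum) : W :=
  \sum_(p <- s) β p.1 p.2.

Definition tens_equiv (s t : fsum) : Prop :=
  forall (W : lmodType C) (β : U -> V -> W),
    bilinear_map β -> tens_eval β s = tens_eval β t.

Definition tensrel (s t : fsum) : bool := `[< tens_equiv s t >].

Fact tensrel_refl : reflexive tensrel.
Proof. by move=> t; apply/asboolP. Qed.
Fact tensrel_sym : symmetric tensrel.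
Proof. by move=> t u; apply/asboolP/asboolP => h W β bβ; rewrite h. Qed.
Fact tensrel_trans : transitive tensrel.
Proof.
move=> t u v /asboolP h1 /asboolP h2; apply/asboolP => W β bβ.
by rewrite h1 // h2.
Qed.

Canonical tensrel_equiv := EquivRel tensrel tensrel_refl tensrel_sym tensrel_trans.
Definition tens := {eq_quot tensrel}.
HB.instance Definition _ := Choice.on tens.
HB.instance Definition _ := EqQuotient.on tens.

Definition tpure (u : U) (v : V) : tens := \pi_tens [:: (u, v)].

Definition tens_lift (W : lmodType C) (β : U -> V -> W) (x : tens) : W :=
  tens_eval β (repr x).

Lemma tens_liftE (W : lmodType C) (β : U -> V -> W) s :
  bilinear_map β -> tens_lift β (\pi_tens s) = tens_eval β s.
Proof.
move=> bβ; rewrite /tens_lift.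
have /eqmodP/asboolP : repr (\pi_tens s) = s %[mod tens] by rewrite reprK.
exact.
Qed.

Lemma tens_eq (x y : tens) :
  (forall (W : lmodType C) (β : U -> V -> W),
     bilinear_map β -> tens_lift β x = tens_lift β y) -> x = y.
Proof.
move=> h; rewrite -[x]reprK -[y]reprK; apply/eqmodP/asboolP => W β bβ.
exact: h.
Qed.

Definition tens_zero : tens := \pi_tens [::].
Definition tens_add (x y : tens) : tens := \pi_tens (repr x ++ repr y).
Definition tens_scale c (x : tens) : tens :=
  \pi_tens [seq (c *: p.1, p.2) | p <- repr x].
Definition tens_opp (x : tens) : tens := tens_scale (-1) x.

Section LiftOps.
Variables (W : lmodType C) (β : U -> V -> W).
Hypothesis bβ : bilinear_map β.
Lemma bilZl a u v : β (a *: u) v = a *: β u v.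
Proof.
have h0 : β 0 v = 0.
  by apply: (addrI (β 0 v)); rewrite -{1}[β 0 v]scale1r -bβ.1 !addr0 scaler0.
by rewrite -[a *: u]addr0 bβ.1 h0 addr0.
Qed.
Fact tens_lift_zero : tens_lift β tens_zero = 0.
Proof. by rewrite tens_liftE // /tens_eval big_nil. Qed.
Fact tens_lift_add x y :
  tens_lift β (tens_add x y) = tens_lift β x + tens_lift β y.
Proof. by rewrite tens_liftE // /tens_eval big_cat. Qed.
Fact tens_lift_scale c x : tens_lift β (tens_scale c x) = c *: tens_lift β x.
Proof.
rewrite tens_liftE // /tens_eval big_map scaler_sumr.
by apply: eq_bigr => p _; rewrite bilZl.
Qed.
End LiftOps.
Let liftE := (tens_lift_zero, tens_lift_add, tens_lift_scale).

Fact tens_addA : associative tens_add.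
Proof. by move=> x y z; apply: tens_eq => W β bβ; rewrite !liftE // addrA. Qed.
Fact tens_addC : commutative tens_add.
Proof. by move=> x y; apply: tens_eq => W β bβ; rewrite !liftE // addrC. Qed.
Fact tens_add0 : left_id tens_zero tens_add.
Proof. by move=> x; apply: tens_eq => W β bβ; rewrite !liftE // add0r. Qed.
Fact tens_addN : left_inverse tens_zero tens_opp tens_add.
Proof.
move=> x; apply: tens_eq => W β bβ.
by rewrite !liftE // scaleN1r addNr.
Qed.
HB.instance Definition _ :=
  GRing.isZmodule.Build tens tens_addA tens_addC tens_add0 tens_addN.

Fact tens_scaleA a b x : tens_scale a (tens_scale b x) = tens_scale (a * b) x.
Proof. by apply: tens_eq => W β bβ; rewrite !liftE // scalerA. Qed.
Fact tens_scale1 : left_id 1 tens_scale.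
Proof. by move=> x; apply: tens_eq => W β bβ; rewrite !liftE // scale1r. Qed.
Fact tens_scaleDr : right_distributive tens_scale +%R.
Proof.
move=> a x y; apply: (@tens_eq _ (tens_add _ _)) => W β bβ.
by rewrite !liftE // scalerDr.
Qed.
Fact tens_scaleDl x : {morph tens_scale^~ x : a b / a + b}.
Proof.
move=> a b; apply: (@tens_eq _ (tens_add _ _)) => W β bβ.
by rewrite !liftE // scalerDl.
Qed.
HB.instance Definition _ := GRing.Zmodule_isLmodule.Build C tens
  tens_scaleA tens_scale1 tens_scaleDr tens_scaleDl.

Section Lift.
Variables (W : lmodType C) (β : U -> V -> W).
Hypothesis bβ : bilinear_map β.
Lemma tens_liftP a x y :
  tens_lift β (a *: x + y) = a *: tens_lift β x + tens_lift β y.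
Proof. by rewrite (tens_lift_add bβ (tens_scale a x)) tens_lift_scale. Qed.
Lemma tens_lift0 : tens_lift β 0 = 0. Proof. exact: tens_lift_zero. Qed.
Lemma tens_liftD x y : tens_lift β (x + y) = tens_lift β x + tens_lift β y.
Proof. exact: tens_lift_add. Qed.
Lemma tens_liftZ a x : tens_lift β (a *: x) = a *: tens_lift β x.
Proof. exact: tens_lift_scale. Qed.
Lemma tens_lift_pure u v : tens_lift β (tpure u v) = β u v.
Proof. by rewrite tens_liftE // /tens_eval big_seq1. Qed.
Lemma tens_lift_sum I (s : seq I) (F : I -> tens) :
  tens_lift β (\sum_(i <- s) F i) = \sum_(i <- s) tens_lift β (F i).
Proof.
by elim: s => [|i s IH]; rewrite ?big_nil ?tens_lift0 // !big_cons tens_liftD IH.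
Qed.
End Lift.

Lemma tpure_bilinear : bilinear_map tpure.
Proof.
by split=> *; apply: tens_eq => W β bβ;
  rewrite tens_liftP // !tens_lift_pure // ?bβ.1 ?bβ.2.
Qed.
Lemma tpure0l v : tpure 0 v = 0.
Proof. by apply: tens_eq => W β bβ; rewrite tens_lift0 // tens_lift_pure // -(scale0r 0) bilZl // scale0r. Qed.
Lemma tpureDl u u' v : tpure (u + u') v = tpure u v + tpure u' v.
Proof. by rewrite -[u]scale1r tpure_bilinear.1 !scale1r. Qed.
Lemma tpureDr u v v' : tpure u (v + v') = tpure u v + tpure u v'.
Proof. by rewrite -[v]scale1r tpure_bilinear.2 !scale1r. Qed.
Lemma tpureZl a u v : tpure (a *: u) v = a *: tpure u v.
Proof. exact: bilZl tpure_bilinear _ _ _. Qed.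
Lemma tpure0r u : tpure u 0 = 0.
Proof.
by apply: (addrI (tpure u 0)); rewrite -tpureDr !addr0.
Qed.
Lemma tpureZr a u v : tpure u (a *: v) = a *: tpure u v.
Proof. by rewrite -[a *: v]addr0 tpure_bilinear.2 tpure0r addr0. Qed.
Lemma tpure_suml I (s : seq I) (F : I -> U) v :
  tpure (\sum_(i <- s) F i) v = \sum_(i <- s) tpure (F i) v.
Proof.
by elim: s => [|i s IH]; rewrite ?big_nil ?tpure0l // !big_cons tpureDl IH.
Qed.
Lemma tpure_sumr I (s : seq I) u (F : I -> V) :
  tpure u (\sum_(i <- s) F i) = \sum_(i <- s) tpure u (F i).
Proof.
by elim: s => [|i s IH]; rewrite ?big_nil ?tpure0r // !big_cons tpureDr IH.
Qed.

Lemma tens_sumE (x : tens) : x = \sum_(p <- repr x) tpure p.1 p.2.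
Proof.
apply: tens_eq => W β bβ; rewrite tens_lift_sum // /tens_lift.
by apply: eq_bigr => p _; rewrite -[RHS]/(tens_lift _ _) tens_lift_pure.
Qed.
Lemma tens_ind (P : tens -> Prop) :
  P 0 -> (forall u v x, P x -> P (tpure u v + x)) -> forall x, P x.
Proof.
move=> P0 PD x; rewrite [x]tens_sumE.
by elim: (repr x) => [|p s IH]; rewrite ?big_nil // big_cons; apply: PD.
Qed.
End Tensor.

Section TensorPreHilbert.
Variables (C : numClosedFieldType) (H G : preHilbertType C).
Local Notation T := (tens H G).

(* ⟨x ⊗ y, x' ⊗ y'⟩ = ⟨x, x'⟩ ⟨y, y'⟩ *)
Definition tens_inner (t u : T) : C :=
  \sum_(p <- repr t) \sum_(q <- repr u) ⟨p.1, q.1⟩ * ⟨p.2, q.2⟩.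

Let slice (p : H * G) (x : H) (y : G) : C^o := ⟨p.1, x⟩ * ⟨p.2, y⟩.
Let slice_bil p : bilinear_map (slice p).
Proof.
split=> a x y z; rewrite /slice innerPr.
  by rewrite mulrDl -mulrA.
by rewrite mulrDr mulrCA.
Qed.

Let tens_innerE t u : tens_inner t u = \sum_(p <- repr t) tens_lift (slice p) u.
Proof. by []. Qed.

Fact tens_innerPr a t u v :
  tens_inner t (a *: u + v) = a * tens_inner t u + tens_inner t v.
Proof.
rewrite !tens_innerE big_distrr -big_split /=; apply: eq_bigr => p _.
exact: (tens_liftP (slice_bil p)).
Qed.
Fact tens_innerC t u : tens_inner t u = (tens_inner u t)^*.
Proof.
rewrite /tens_inner rmorph_sum exchange_big /=; apply: eq_bigr => p _.
by rewrite rmorph_sum; apply: eq_bigr => q _ /=; rewrite rmorphM /= -!innerC.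
Qed.
Let innerDr' t u v : tens_inner t (u + v) = tens_inner t u + tens_inner t v.
Proof. by rewrite -{1}[u]scale1r tens_innerPr mul1r. Qed.
Let inner0r' t : tens_inner t 0 = 0.
Proof. by apply: (addrI (tens_inner t 0)); rewrite -innerDr' !addr0. Qed.
Let inner_sumr' t (s : seq (H * G)) (F : H * G -> T) :
  tens_inner t (\sum_(p <- s) F p) = \sum_(p <- s) tens_inner t (F p).
Proof.
by elim: s => [|p s IH]; rewrite ?big_nil ?inner0r' // !big_cons innerDr' IH.
Qed.
Let inner_suml' t (s : seq (H * G)) (F : H * G -> T) :
  tens_inner (\sum_(p <- s) F p) t = \sum_(p <- s) tens_inner (F p) t.
Proof.
rewrite tens_innerC inner_sumr' rmorph_sum; apply: eq_bigr => p _ /=.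
by rewrite -tens_innerC.
Qed.
Lemma tens_inner_pure x y x' y' :
  tens_inner (tpure x y) (tpure x' y') = ⟨x, x'⟩ * ⟨y, y'⟩.
Proof.
have h t : tens_inner t (tpure x' y') = \sum_(p <- repr t) slice p x' y'.
  by rewrite tens_innerE; apply: eq_bigr => p _; rewrite tens_lift_pure.
have h' t : tens_inner (tpure x' y') t = tens_lift (slice (x', y')) t.
  rewrite tens_innerC h rmorph_sum; apply: eq_bigr => p _ /=.
  by rewrite /slice /= rmorphM /= -!innerC.
by rewrite tens_innerC h' tens_lift_pure // /slice /= rmorphM /= -!innerC.
Qed.

(* Gram-Schmidt: every tensor is a sum of x_i ⊗ e_i with the e_i pairwise
   orthogonal *)
Let orth (p q : H * G) := ⟨p.2, q.2⟩ == 0.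
Let orth_coef (y : G) (p : H * G) := ⟨p.2, y⟩ / ⟨p.2, p.2⟩.
Let orth_sum (s : seq (H * G)) : T := \sum_(p <- s) tpure p.1 p.2.

Let orth_proj y s p : pairwise orth s -> p \in s ->
  \sum_(q <- s) orth_coef y q * ⟨p.2, q.2⟩ = ⟨p.2, y⟩.
Proof.
elim: s => [//|q s IH] /= /andP[/allP qs ps]; rewrite inE big_cons.
case/predU1P => [->|pins].
  rewrite big_seq big1 => [|r rs]; last by rewrite (eqP (qs _ rs)) mulr0.
  rewrite addr0 /orth_coef; have [e0|e0] := eqVneq ⟨q.2, q.2⟩ 0.
    by rewrite (inner_eq0 _ e0) !inner0l mulr0.
  by rewrite divfK.
rewrite IH //; have /eqP e := qs _ pins.
by rewrite innerC e conjC0 mulr0 add0r.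
Qed.

Let orth_expand (t : T) : exists2 s, t = orth_sum s & pairwise orth s.
Proof.
elim/tens_ind: t => [|x y t [s -> os]]; first by exists [::]; rewrite // /orth_sum big_nil.
pose r := y - \sum_(q <- s) orth_coef y q *: q.2.
exists ((x, r) :: [seq (p.1 + orth_coef y p *: x, p.2) | p <- s]).
  rewrite /orth_sum big_cons big_map /= .
  under [X in _ = _ + X]eq_bigr do rewrite tpureDl tpureZl -tpureZr.
  rewrite big_split /= -tpure_sumr addrCA addrC; congr (_ + _).
  by rewrite -tpureDr subrK.
rewrite /= pairwise_map; apply/andP; split; last by [].
apply/allP => _ /mapP[p pins ->]; rewrite /orth /= innerC innerBr inner_sumr.
under eq_bigr do rewrite innerZr.
by rewrite orth_proj // subrr conjC0.
Qed.

Let orth_norm s : pairwise orth s ->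
  tens_inner (orth_sum s) (orth_sum s) =
  \sum_(p <- s) ⟨p.1, p.1⟩ * ⟨p.2, p.2⟩.
Proof.
move=> os; rewrite inner_suml'.
elim: s os => [|p s IH]; first by rewrite !big_nil.
move=> /= /andP[/allP ps os]; rewrite !big_cons.
have z q : q \in s -> tens_inner (tpure q.1 q.2) (tpure p.1 p.2) = 0.
  move=> qs; rewrite tens_inner_pure [⟨q.2, _⟩]innerC (eqP (ps _ qs)).
  by rewrite conjC0 mulr0.
congr (_ + _).
  rewrite /orth_sum big_cons innerDr' tens_inner_pure inner_sumr' big_seq big1 ?addr0 //.
  by move=> q qs; rewrite tens_innerC z // conjC0.
rewrite -IH // [LHS]big_seq [RHS]big_seq; apply: eq_bigr => q qs.
by rewrite [orth_sum (_ :: _)]big_cons innerDr' z // add0r.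
Qed.

Fact tens_inner_ge0 t : 0 <= tens_inner t t.
Proof.
have [s -> os] := orth_expand t; rewrite orth_norm //.
by apply: sumr_ge0 => p _; rewrite mulr_ge0 ?inner_ge0.
Qed.
Fact tens_inner_eq0 t : tens_inner t t = 0 -> t = 0.
Proof.
have [s -> os] := orth_expand t; rewrite orth_norm // => /eqP.
rewrite psumr_eq0 => [/allP h|p _]; last by rewrite mulr_ge0 ?inner_ge0.
rewrite /orth_sum big_seq big1 // => p ps.
have := h _ ps; rewrite mulf_eq0 => /orP[]/eqP/inner_eq0 ->.
  exact: tpure0l.
exact: tpure0r.
Qed.
Fact tens_inner_vac : tens_inner (tpure Ω Ω) (tpure Ω Ω) = 1.
Proof. by rewrite tens_inner_pure !inner_vacuum mulr1. Qed.

HB.instance Definition _ := isPreHilbert.Build C T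
  tens_innerPr tens_innerC tens_inner_ge0 tens_inner_eq0 tens_inner_vac.

Lemma inner_pure x y x' y' :
  ⟨tpure x y : T, tpure x' y'⟩ = ⟨x, x'⟩ * ⟨y, y'⟩.
Proof. exact: tens_inner_pure. Qed.

Section TensorOp.
Let mapop (X : adjop H) (Y : adjop G) (x : H) (y : G) : T := tpure (X x) (Y y).
Let mapop_bil X Y : bilinear_map (mapop X Y).
Proof.
split=> a u v w; rewrite /mapop opP; first exact: (tpure_bilinear _ _).1.
exact: (tpure_bilinear _ _).2.
Qed.
Variables (X : adjop H) (Y : adjop G).
Fact tens_opP (t u : T) :
  ⟨tens_lift (mapop X Y) t, u⟩ = ⟨t, tens_lift (mapop (op_star X) (op_star Y)) u⟩.
Proof.
elim/tens_ind: t => [|x y t IH]; first by rewrite tens_lift0 // !inner0l.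
rewrite tens_liftD // !innerDl IH tens_lift_pure //; congr (_ + _).
elim/tens_ind: u {IH} => [|x' y' u IHu]; first by rewrite tens_lift0 // !inner0r.
rewrite tens_liftD // !innerDr IHu tens_lift_pure //; congr (_ + _).
by rewrite /mapop !inner_pure !opadjP.
Qed.
Definition tens_op : adjop T :=
  @AdjOp C T (tens_lift (fun x y => tpure (X x) (Y y)))
    (tens_lift (fun x y => tpure (opadj X x) (opadj Y y))) tens_opP.

Lemma tens_op_pure x y : tens_op (tpure x y) = tpure (X x) (Y y).
Proof. exact: (tens_lift_pure (mapop_bil X Y)). Qed.
End TensorOp.

Lemma tens_op_ext (X Y : adjop T) :
  (forall x y, X (tpure x y) = Y (tpure x y)) -> X = Y.
Proof.
move=> h; apply: adjop_ext; elim/tens_ind => [|x y t IH]; first by rewrite !op0.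
by rewrite !opD h IH.
Qed.

Lemma tens_opPl a X X' Y :
  tens_op (a *: X + X') Y = a *: tens_op X Y + tens_op X' Y.
Proof.
apply: tens_op_ext => x y.
rewrite -[RHS]/(a *: tens_op X Y (tpure x y) + tens_op X' Y (tpure x y)).
by rewrite !tens_op_pure (tpure_bilinear _ _).1.
Qed.
Lemma tens_opPr a X Y Y' :
  tens_op X (a *: Y + Y') = a *: tens_op X Y + tens_op X Y'.
Proof.
apply: tens_op_ext => x y.
rewrite -[RHS]/(a *: tens_op X Y (tpure x y) + tens_op X Y' (tpure x y)).
by rewrite !tens_op_pure (tpure_bilinear _ _).2.
Qed.
Lemma tens_opM X X' Y Y' :
  tens_op (X ⋅ X') (Y ⋅ Y') = tens_op X Y ⋅ tens_op X' Y'.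
Proof.
apply: tens_op_ext => x y.
rewrite -[RHS]/(tens_op X Y (tens_op X' Y' (tpure x y))).
by rewrite !tens_op_pure.
Qed.
Lemma tens_op_star X Y : tens_op X^† Y^† = (tens_op X Y)^†.
Proof. exact: adjop_ext. Qed.
Lemma tens_op0l Y : tens_op 0 Y = 0.
Proof. by apply: tens_op_ext => x y; rewrite tens_op_pure tpure0l. Qed.
Lemma tens_op0r X : tens_op X 0 = 0.
Proof. by apply: tens_op_ext => x y; rewrite tens_op_pure tpure0r. Qed.

(* λ^γ_{H,G} and ρ^δ_{H,G} *)
Definition lift_left (γ : C) (X : adjop H) : adjop T :=
  tens_op X (proj_vac G) + tens_op (twist γ X) (proj_perp G).
Definition lift_right (δ : C) (Y : adjop G) : adjop T :=
  tens_op (proj_vac H) Y + tens_op (proj_perp H) (twist δ Y).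
End TensorPreHilbert.

Section LiftHom.
Variables (C : numClosedFieldType) (H G : preHilbertType C).
Variable γ : C.
Hypothesis hγ : `|γ| = 1 \/ γ = 0.

Lemma proj_vac2 (K : preHilbertType C) : proj_vac K ⋅ proj_vac K = proj_vac K.
Proof.
apply: adjop_ext => x.
rewrite -[LHS]/(⟨Ω, ⟨Ω, x⟩ *: Ω⟩ *: (Ω : K)) innerZr inner_vacuum mulr1.
by [].
Qed.
Lemma proj_perp2 (K : preHilbertType C) : proj_perp K ⋅ proj_perp K = proj_perp K.
Proof. by apply: adjop_ext => x; apply: proj_perpK. Qed.
Lemma proj_vac_perp (K : preHilbertType C) : proj_vac K ⋅ proj_perp K = 0.
Proof.
apply: adjop_ext => x.
by rewrite -[LHS]/(⟨Ω, proj_perp K x⟩ *: (Ω : K)) inner_vac_perp scale0r.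
Qed.
Lemma proj_perp_vac0 (K : preHilbertType C) : proj_perp K ⋅ proj_vac K = 0.
Proof.
apply: adjop_ext => x.
by rewrite -[LHS]/(proj_perp K (⟨Ω, x⟩ *: Ω)) opZ proj_perp_vac scaler0.
Qed.
Let pE := (proj_vac2, proj_perp2, proj_vac_perp, proj_perp_vac0).
Lemma proj_vac_star (K : preHilbertType C) : (proj_vac K)^† = proj_vac K.
Proof. exact: adjop_ext. Qed.
Lemma proj_perp_star (K : preHilbertType C) : (proj_perp K)^† = proj_perp K.
Proof. exact: adjop_ext. Qed.

Lemma lift_left_hom : star_hom (@lift_left C H G γ).
Proof.
have th := twist_hom H hγ.
split=> [a X Y _ _|X Y _ _|X _]; rewrite /lift_left.
- by rewrite (homP th) !tens_opPl scalerDr addrACA.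
- rewrite (homM th) !smulDl !smulDr -!tens_opM !pE !tens_op0r.
  by rewrite addr0 add0r.
- by rewrite (homS th) starD -!tens_op_star proj_vac_star proj_perp_star.
Qed.
Lemma lift_right_hom : star_hom (@lift_right C H G γ).
Proof.
have th := twist_hom G hγ.
split=> [a X Y _ _|X Y _ _|X _]; rewrite /lift_right.
- by rewrite (homP th) !tens_opPr scalerDr addrACA.
- rewrite (homM th) !smulDl !smulDr -!tens_opM !pE !tens_op0l.
  by rewrite addr0 add0r.
- by rewrite (homS th) starD -!tens_op_star proj_vac_star proj_perp_star.
Qed.
End LiftHom.

Section Unitization.
Variables (C : numClosedFieldType) (A : starAlgType C).

(* C1 ⊕ A, with (λ, a) standing for λ1 + a *)
Definition unitization : Type := (C^o * A)%type.
HB.instance Definition _ := GRing.Lmodule.on unitization.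
Implicit Types x y z : unitization.

Definition unitz_mul x y : unitization :=
  (x.1 * y.1, x.1 *: y.2 + y.1 *: x.2 + x.2 ⋅ y.2).
Definition unitz_star x : unitization := (x.1^*, x.2^†).

Let E (x y : unitization) : x.1 = y.1 -> x.2 = y.2 -> x = y.
Proof. by case: x y => [? ?] [? ?] /= -> ->. Qed.

Fact unitz_mulA x y z :
  unitz_mul x (unitz_mul y z) = unitz_mul (unitz_mul x y) z.
Proof.
apply: E => /=; first exact: mulrA.
rewrite !smulDl !smulDr !smulZl !smulZr !scalerDr !scalerA smulA.
rewrite [z.1 * x.1]mulrC [z.1 * y.1]mulrC !addrA.
by rewrite [LHS](ACl (1*2*4*6*3*5*7)).
Qed.
Fact unitz_mulPl a x y z :
  unitz_mul (a *: x + y) z = a *: unitz_mul x z + unitz_mul y z.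
Proof.
apply: E => /=; first by rewrite mulrDl -mulrA.
rewrite smulPl !scalerDr !scalerDl !scalerA [z.1 * a]mulrC !addrA.
by rewrite [LHS](ACl (1*3*5*2*4*6)).
Qed.
Fact unitz_mulPr a x y z :
  unitz_mul x (a *: y + z) = a *: unitz_mul x y + unitz_mul x z.
Proof.
apply: E => /=; first by rewrite mulrDr mulrCA.
rewrite smulPr !scalerDr !scalerDl !scalerA [x.1 * a]mulrC !addrA.
by rewrite [LHS](ACl (1*3*5*2*4*6)).
Qed.
Fact unitz_starP a x y :
  unitz_star (a *: x + y) = a^* *: unitz_star x + unitz_star y.
Proof.
by apply: E => /=; rewrite ?starP // rmorphD rmorphM.
Qed.
Fact unitz_starM x y :
  unitz_star (unitz_mul x y) = unitz_mul (unitz_star y) (unitz_star x).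
Proof.
apply: E => /=; first by rewrite rmorphM mulrC.
by rewrite !starD !starZ starM [X in X + _]addrC.
Qed.
Fact unitz_starK x : unitz_star (unitz_star x) = x.
Proof. by apply: E => /=; rewrite ?conjCK ?starK. Qed.
HB.instance Definition _ := isStarAlgebra.Build C unitization
  unitz_mulA unitz_mulPl unitz_mulPr unitz_starP unitz_starM unitz_starK.

Definition unital_ext (f : A -> C) (x : unitization) : C := x.1 + f x.2.
End Unitization.

Definition positive_functional (C : numClosedFieldType) (A : starAlgType C)
  (f : A -> C) : Prop := forall x, 0 <= f (x^† ⋅ x).

Record state (C : numClosedFieldType) (A : starAlgType C) := State {
  state_fun :> A -> C;
  state_linear : forall a x y,
    state_fun (a *: x + y) = a * state_fun x + state_fun y;
  state_positive : positive_functional (unital_ext state_fun)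
}.

Definition represents (C : numClosedFieldType) (A : starAlgType C) (φ : A -> C)
    (H : preHilbertType C) (π : A -> adjop H) : Prop :=
  star_hom π /\ forall a, φ a = ⟨Ω, π a Ω⟩.

Section SemiInner.
Variables (C : numClosedFieldType) (V : lmodType C) (B : V -> V -> C).
Hypothesis BPr : forall a x y z, B x (a *: y + z) = a * B x y + B x z.
Hypothesis BPl : forall a x y z, B (a *: x + y) z = a^* * B x z + B y z.
Hypothesis B_ge0 : forall x, 0 <= B x x.

Lemma semi_innerC x y : B x y = (B y x)^*.
Proof.
have rl z : (B z z)^* = B z z by apply/CrealP; rewrite realE B_ge0.
have h1 := rl (1 *: x + y); have h2 := rl ('i *: x + y).
move: h1 h2; rewrite !BPr !BPl !rmorphD !rmorphM /=.
rewrite ?rmorphD ?rmorphM /= !conjCK !rl conjCi conjC1.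
move: (B x x) (B y y) (B x y) (B y x) => a b c d h1 h2.
move/eqP: h1; move/eqP: h2; rewrite -subr_eq0 => /eqP h2.
rewrite -subr_eq0 => /eqP h1.
have i2 : 'i * 'i = -1 :> C by rewrite -expr2 sqrCi.
have e1 : (d^* - c) + (c^* - d) = 0 by rewrite -h1; ring.
have e2 : (d^* - c) - (c^* - d) = 0.
  have e : 'i * ((c^* - d) - (d^* - c)) = 0 by rewrite -h2; ring.
  move/eqP: e; rewrite mulf_eq0 (negPf (neq0Ci C)) => /eqP e.
  by rewrite -opprB e oppr0.
have e3 : (d^* - c) *+ 2 = 0 by rewrite mulr2n -[RHS](addr0 0) -{1}e1 -e2; ring.
move/eqP: e3; rewrite mulrn_eq0 /= subr_eq0 => /eqP e3.
by rewrite e3.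
Qed.

Lemma semi_inner_null x y : B x x = 0 -> B y x = 0.
Proof.
move=> x0; apply/eqP; rewrite -normr_eq0; apply/negPn/negP => n0.
have n0' : 0 < `|B y x| ^+ 2 by rewrite exprn_gt0 // lt_def n0 normr_ge0.
pose s := (B y y + 1) / `|B y x| ^+ 2.
have sr : s^* = s.
  apply/CrealP; rewrite realE divr_ge0 ?(ltW n0') //.
  by rewrite addr_ge0 ?ler01.
have h := B_ge0 (- s * (B y x)^* *: x + y).
move: h; rewrite !BPr !BPl x0 [B x y]semi_innerC !rmorphM rmorphN /= sr conjCK.
have -> : - s * (B y x)^* * (- s * B y x * 0 + B y x) +
          (- s * B y x * (B y x)^* + B y y)
        = B y y - (s * (B y x * (B y x)^*)) *+ 2 by rewrite mulr2n; ring.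
rewrite -normCK /s divfK ?gt_eqF // mulrnDl opprD addrA mulr2n opprD addNKr.
rewrite -opprD oppr_ge0 => /le_lt_trans/(_ (ltr_wpDl (B_ge0 y) (ltr0n _ 2))).
by rewrite ltxx.
Qed.
End SemiInner.
(* The GNS representation of a state: the unitization modulo the null space of
   (x, y) ↦ φ(x* y). *)
Section GNS.
Variables (C : numClosedFieldType) (A : starAlgType C) (φ : state A).
Local Notation U := (unitization A).

Definition gns_form (x y : U) : C := unital_ext φ (x^† ⋅ y).

Let extP a (x y : U) :
  unital_ext φ (a *: x + y) = a * unital_ext φ x + unital_ext φ y.
Proof.
rewrite /unital_ext state_linear -[(_ + _).1]/(a * x.1 + y.1).
move: (x.1 : C) (y.1 : C) => u v; ring.
Qed.
Lemma gns_formPr a x y z :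
  gns_form x (a *: y + z) = a * gns_form x y + gns_form x z.
Proof. by rewrite /gns_form smulPr extP. Qed.
Lemma gns_formPl a x y z :
  gns_form (a *: x + y) z = a^* * gns_form x z + gns_form y z.
Proof. by rewrite /gns_form starP smulPl extP. Qed.
Lemma gns_form_ge0 x : 0 <= gns_form x x.
Proof. exact: state_positive. Qed.
Lemma gns_formC x y : gns_form x y = (gns_form y x)^*.
Proof. exact: (semi_innerC gns_formPr gns_formPl gns_form_ge0). Qed.
Lemma gns_form_null x y : gns_form x x = 0 -> gns_form y x = 0.
Proof. exact: (semi_inner_null gns_formPr gns_formPl gns_form_ge0). Qed.

Definition gnsrel (x y : U) : bool :=
  `[< forall z, gns_form z x = gns_form z y >].
Fact gnsrel_refl : reflexive gnsrel.
Proof. by move=> t; apply/asboolP. Qed.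
Fact gnsrel_sym : symmetric gnsrel.
Proof. by move=> t u; apply/asboolP/asboolP => h z; rewrite h. Qed.
Fact gnsrel_trans : transitive gnsrel.
Proof.
by move=> t u v /asboolP h1 /asboolP h2; apply/asboolP => z; rewrite h1 h2.
Qed.
Canonical gnsrel_equiv := EquivRel gnsrel gnsrel_refl gnsrel_sym gnsrel_trans.
Definition gns := {eq_quot gnsrel}.
HB.instance Definition _ := Choice.on gns.
HB.instance Definition _ := EqQuotient.on gns.

Let ev (z : U) (x : gns) : C := gns_form z (repr x).
Let evE z x : ev z (\pi_gns x) = gns_form z x.
Proof.
have /eqmodP/asboolP : repr (\pi_gns x) = x %[mod gns] by rewrite reprK.
exact.
Qed.
Let gns_eq x y : (forall z, ev z x = ev z y) -> x = y.
Proof.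
by move=> h; rewrite -[x]reprK -[y]reprK; apply/eqmodP/asboolP => z; apply: h.
Qed.

Definition gns_zero : gns := \pi_gns 0.
Definition gns_add (x y : gns) : gns := \pi_gns (repr x + repr y).
Definition gns_scale a (x : gns) : gns := \pi_gns (a *: repr x).
Definition gns_opp (x : gns) : gns := gns_scale (-1) x.

Let ev_add z x y : ev z (gns_add x y) = ev z x + ev z y.
Proof.
rewrite evE -[X in gns_form _ (X + _)]scale1r.
by rewrite [LHS]gns_formPr mul1r.
Qed.
Let form0 z : gns_form z 0 = 0.
Proof.
have := gns_formPr 1 z 0 0; rewrite scaler0 mul1r addr0 => /eqP.
by rewrite -subr_eq subrr => /eqP <-.
Qed.
Let ev_zero z : ev z gns_zero = 0.
Proof. by rewrite evE form0. Qed.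
Let ev_scale z a x : ev z (gns_scale a x) = a * ev z x.
Proof.
by rewrite evE -[X in gns_form _ X]addr0 [LHS]gns_formPr form0 addr0.
Qed.
Let evs := (ev_add, ev_zero, ev_scale).

Fact gns_addA : associative gns_add.
Proof. by move=> x y z; apply: gns_eq => w; rewrite !evs addrA. Qed.
Fact gns_addC : commutative gns_add.
Proof. by move=> x y; apply: gns_eq => w; rewrite !evs addrC. Qed.
Fact gns_add0 : left_id gns_zero gns_add.
Proof. by move=> x; apply: gns_eq => w; rewrite !evs add0r. Qed.
Fact gns_addN : left_inverse gns_zero gns_opp gns_add.
Proof. by move=> x; apply: gns_eq => w; rewrite !evs mulN1r addNr. Qed.
HB.instance Definition _ :=
  GRing.isZmodule.Build gns gns_addA gns_addC gns_add0 gns_addN.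

Fact gns_scaleA a b x : gns_scale a (gns_scale b x) = gns_scale (a * b) x.
Proof. by apply: gns_eq => w; rewrite !evs mulrA. Qed.
Fact gns_scale1 : left_id 1 gns_scale.
Proof. by move=> x; apply: gns_eq => w; rewrite !evs mul1r. Qed.
Fact gns_scaleDr : right_distributive gns_scale +%R.
Proof.
move=> a x y; apply: (@gns_eq _ (gns_add _ _)) => w.
by rewrite evs [in LHS]ev_add !evs mulrDr.
Qed.
Fact gns_scaleDl x : {morph gns_scale^~ x : a b / a + b}.
Proof.
move=> a b; apply: (@gns_eq _ (gns_add _ _)) => w.
by rewrite !evs mulrDl.
Qed.
HB.instance Definition _ := GRing.Zmodule_isLmodule.Build C gns
  gns_scaleA gns_scale1 gns_scaleDr gns_scaleDl.

Let evP z a x y : ev z (a *: x + y) = a * ev z x + ev z y.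
Proof. by rewrite [LHS]ev_add ev_scale. Qed.

Definition gns_inner (x y : gns) : C := gns_form (repr x) (repr y).
Definition gns_vac : gns := \pi_gns (1, 0).

Lemma gns_inner_pi x y : gns_inner (\pi_gns x) (\pi_gns y) = gns_form x y.
Proof. by rewrite [LHS]evE gns_formC [gns_form _ _]evE -gns_formC. Qed.
Fact gns_innerPr a x y z :
  gns_inner x (a *: y + z) = a * gns_inner x y + gns_inner x z.
Proof. exact: evP. Qed.
Fact gns_innerC x y : gns_inner x y = (gns_inner y x)^*.
Proof. exact: gns_formC. Qed.
Fact gns_inner_ge0 x : 0 <= gns_inner x x.
Proof. exact: gns_form_ge0. Qed.
Fact gns_inner_eq0 x : gns_inner x x = 0 -> x = 0.
Proof.
move=> x0; apply: gns_eq => z; rewrite [RHS]ev_zero; exact: gns_form_null.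
Qed.
Fact gns_inner_vac : gns_inner gns_vac gns_vac = 1.
Proof.
rewrite gns_inner_pi /gns_form /unital_ext /= conjC1 mul1r.
rewrite !scaler0 star0 scaler0 smul0r !addr0.
have := state_linear φ 1 0 0; rewrite scaler0 mul1r addr0 => /eqP.
by rewrite -subr_eq subrr => /eqP <-; rewrite addr0.
Qed.
HB.instance Definition _ := isPreHilbert.Build C gns
  gns_innerPr gns_innerC gns_inner_ge0 gns_inner_eq0 gns_inner_vac.

Let unitz_in (a : A) : U := (0, a).
Let unitz_in_star a : (unitz_in a)^† = unitz_in a^†.
Proof. by rewrite /unitz_in /star /= /unitz_star /= conjC0. Qed.
Let form_mul a x y : gns_form (unitz_in a ⋅ x) y = gns_form x (unitz_in a^† ⋅ y).
Proof. by rewrite /gns_form starM unitz_in_star smulA. Qed.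

Definition gns_fun (a : A) (x : gns) : gns := \pi_gns (((0, a) : U) ⋅ repr x).
Fact gns_fun_adj a (x y : gns) : ⟨gns_fun a x, y⟩ = ⟨x, gns_fun a^† y⟩.
Proof.
rewrite -[x in RHS]reprK -[y in LHS]reprK.
by rewrite [LHS]gns_inner_pi [RHS]gns_inner_pi -/(unitz_in a) form_mul.
Qed.
Definition gns_rep (a : A) : adjop gns :=
  AdjOp (gns_fun_adj a).

Lemma gns_rep_pi a x : gns_rep a (\pi_gns x) = \pi_gns (((0, a) : U) ⋅ x).
Proof.
apply: gns_eq => z; rewrite !evE.
rewrite -[a in LHS]starK -[a in RHS]starK -!form_mul; exact: evE.
Qed.

Let ev_rep z a x : ev z (gns_rep a x) = ev (unitz_in a^† ⋅ z) x.
Proof. by rewrite -[x]reprK gns_rep_pi !evE form_mul starK. Qed.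

Lemma gns_represents : represents φ gns_rep.
Proof.
split; last first.
  move=> a; rewrite -[Ω]/gns_vac gns_rep_pi [RHS]gns_inner_pi /gns_form.
  rewrite /unital_ext /= conjC1 star0 !mul1r mul0r add0r !smul0l !scaler0.
  by rewrite ?scale1r ?smul0r ?(addr0, add0r).
split=> [c a b _ _|a b _ _|a _]; apply: adjop_ext => // x.
- rewrite -[RHS]/(c *: gns_rep a x + gns_rep b x).
  apply: gns_eq => z; rewrite evP !ev_rep starP.
  have -> : unitz_in (c^* *: a^† + b^†) ⋅ z
          = c^* *: (unitz_in a^† ⋅ z) + unitz_in b^† ⋅ z.
    rewrite -smulPl; congr (_ ⋅ _).
    by rewrite /unitz_in; congr pair; rewrite -[RHS]/(c^* * 0 + 0) mulr0 addr0.
  by rewrite [LHS]gns_formPl conjCK.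
- rewrite -[RHS]/(gns_rep a (gns_rep b x)).
  apply: gns_eq => z; rewrite !ev_rep starM smulA; congr (ev (_ ⋅ _) _).
  rewrite /unitz_in /smul /= /unitz_mul /= mul0r !scale0r !add0r.
  by [].
Qed.
End GNS.

Section VacuumState.
Variables (C : numClosedFieldType) (A : starAlgType C) (H : preHilbertType C).
Variable π : A -> adjop H.
Hypothesis πh : star_hom π.

Fact vacuum_linear a x y :
  ⟨Ω, π (a *: x + y) Ω⟩ = a * ⟨Ω, π x Ω⟩ + ⟨Ω, π y Ω⟩.
Proof. by rewrite homP // [LHS]innerPr. Qed.

Fact vacuum_positive :
  positive_functional (unital_ext (fun a => ⟨Ω, π a Ω⟩)).
Proof.
move=> x; pose w := x.1 *: Ω + π x.2 Ω : H.
suff -> : unital_ext (fun a => ⟨Ω, π a Ω⟩) (x^† ⋅ x) = ⟨w, w⟩.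
  exact: inner_ge0.
rewrite /unital_ext /= !(homD πh) !(homZ πh) (homM πh) (homS πh).
rewrite -[opfun _ Ω]/(x.1^* *: π x.2 Ω + x.1 *: opadj (π x.2) Ω
  + opadj (π x.2) (π x.2 Ω)).
rewrite /w innerDl !innerDr !innerZl !innerZr inner_vacuum -!opadjP.
ring.
Qed.

Definition vacuum_state : state A := State vacuum_linear vacuum_positive.
End VacuumState.

(* The underlying *-algebra is, via the inclusions, the coproduct of the two
   *-subalgebras face1 and face2. *)
Record twoFaced (C : numClosedFieldType) := TwoFaced {
  tf_alg :> starAlgType C;
  face1 : set tf_alg;
  face2 : set tf_alg;
  face1_sub : star_subalgebra face1;
  face2_sub : star_subalgebra face2;
  face_coprod : forall (D : starAlgType C) (f g : tf_alg -> D),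
    star_hom_on face1 f -> star_hom_on face2 g ->
    exists! h : tf_alg -> D,
      [/\ star_hom h, forall a, face1 a -> h a = f a & forall a, face2 a -> h a = g a]
}.
Arguments face1 {C} t.
Arguments face2 {C} t.

Section AssociatedProduct.
Variables (C : numClosedFieldType) (γ1 δ1 γ2 δ2 : C).

Section JointRep.
Variables (A B : twoFaced C) (H G : preHilbertType C).
Variables (π : A -> adjop H) (σ : B -> adjop G).

Definition is_joint_rep (Π : fprod A B -> adjop (tens H G)) : Prop :=
  [/\ star_hom Π,
      forall a, face1 A a -> Π (fp_inl B a) = lift_left G γ1 (π a),
      forall a, face2 A a -> Π (fp_inl B a) = lift_left G γ2 (π a),
      forall b, face1 B b -> Π (fp_inr A b) = lift_right H δ1 (σ b) &
      forall b, face2 B b -> Π (fp_inr A b) = lift_right H δ2 (σ b)].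

Definition joint_rep : fprod A B -> adjop (tens H G) :=
  xget (fun _ => 0) [set Π | is_joint_rep Π].

Lemma joint_rep_hom : star_hom joint_rep.
Proof.
rewrite /joint_rep; case: xgetP => [Π _ []//|_].
by split=> *; rewrite ?scaler0 ?addr0 ?smul0l ?star0.
Qed.

(* For the parameters of interest Π exists and is unique, so that the default
   value 0 in joint_rep is irrelevant. *)
Section Existence.
Hypotheses (hγ1 : `|γ1| = 1 \/ γ1 = 0) (hδ1 : `|δ1| = 1 \/ δ1 = 0).
Hypotheses (hγ2 : `|γ2| = 1 \/ γ2 = 0) (hδ2 : `|δ2| = 1 \/ δ2 = 0).
Hypotheses (πh : star_hom π) (σh : star_hom σ).

Lemma star_hom_onT (D E : starAlgType C) (f : D -> E) S :
  star_hom f -> star_hom_on S f.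
Proof. by case=> h1 h2 h3; split=> *; [apply: h1|apply: h2|apply: h3]. Qed.

Lemma is_joint_rep_ex : exists Π, is_joint_rep Π.
Proof.
have hl γ : `|γ| = 1 \/ γ = 0 -> star_hom (@lift_left C H G γ \o π).
  by move=> hγ; apply: star_hom_comp => //; apply: lift_left_hom.
have hr δ : `|δ| = 1 \/ δ = 0 -> star_hom (@lift_right C H G δ \o σ).
  by move=> hδ; apply: star_hom_comp => //; apply: lift_right_hom.
have [f [[fh f1 f2] _]] := face_coprod (star_hom_onT (face1 A) (hl _ hγ1))
  (star_hom_onT (face2 A) (hl _ hγ2)).
have [g [[gh g1 g2] _]] := face_coprod (star_hom_onT (face1 B) (hr _ hδ1))
  (star_hom_onT (face2 B) (hr _ hδ2)).
exists (fp_lift f g); split; first exact: fp_lift_hom.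
- by move=> a /f1 e; rewrite fp_lift_inl // e.
- by move=> a /f2 e; rewrite fp_lift_inl // e.
- by move=> b /g1 e; rewrite fp_lift_inr // e.
- by move=> b /g2 e; rewrite fp_lift_inr // e.
Qed.

Lemma joint_repP : is_joint_rep joint_rep.
Proof. by have [Π Πh] := is_joint_rep_ex; apply: xgetI Πh. Qed.

Lemma joint_rep_unique Π : is_joint_rep Π -> Π = joint_rep.
Proof.
case=> Πh Πa1 Πa2 Πb1 Πb2; have [Jh Ja1 Ja2 Jb1 Jb2] := joint_repP.
have eA : Π \o @fp_inl C A B = joint_rep \o @fp_inl C A B.
  have hA (F : fprod A B -> adjop (tens H G)) :
    star_hom F -> star_hom (F \o @fp_inl C A B).
    by apply: star_hom_comp; apply: fp_inl_hom.
  have [h [_ hu]] := face_coprod (star_hom_onT (face1 A) (hA _ Jh))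
    (star_hom_onT (face2 A) (hA _ Jh)).
  transitivity h; [apply/esym|]; apply: hu; split=> //; try exact: hA.
    by move=> a aA; rewrite /= Πa1 // Ja1.
  by move=> a aA; rewrite /= Πa2 // Ja2.
have eB : Π \o @fp_inr C A B = joint_rep \o @fp_inr C A B.
  have hB (F : fprod A B -> adjop (tens H G)) :
    star_hom F -> star_hom (F \o @fp_inr C A B).
    by apply: star_hom_comp; apply: fp_inr_hom.
  have [h [_ hu]] := face_coprod (star_hom_onT (face1 B) (hB _ Jh))
    (star_hom_onT (face2 B) (hB _ Jh)).
  transitivity h; [apply/esym|]; apply: hu; split=> //; try exact: hB.
    by move=> b bB; rewrite /= Πb1 // Jb1.
  by move=> b bB; rewrite /= Πb2 // Jb2.
have hl (F : fprod A B -> adjop (tens H G)) : star_hom F ->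
    F =1 fp_lift (F \o @fp_inl C A B) (F \o @fp_inr C A B).
  move=> Fh; apply: fp_lift_unique => //.
    by apply: star_hom_comp => //; apply: fp_inl_hom.
  by apply: star_hom_comp => //; apply: fp_inr_hom.
by apply/funext => x; rewrite hl // eA eB -hl.
Qed.
End Existence.
End JointRep.

(* φ ⊙ ψ for ⊙ = T(γ1, δ1; γ2, δ2), computed in the GNS representations of φ
   and ψ *)
Definition Tprod (A B : twoFaced C) (φ : state A) (ψ : state B) :
    state (fprod A B) :=
  vacuum_state (joint_rep_hom (gns_rep φ) (gns_rep ψ)).
End AssociatedProduct.

Section TwoFacedCoproduct.
Variables (C : numClosedFieldType) (A1 A2 : starAlgType C).

Lemma range_subalgebra (A B : starAlgType C) (f : A -> B) :
  star_hom f -> star_subalgebra (range f).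
Proof.
move=> fh; split.
- by exists 0 => //; apply: hom0.
- by move=> a _ _ [x _ <-] [y _ <-]; exists (a *: x + y); rewrite ?homP.
- by move=> _ _ [x _ <-] [y _ <-]; exists (x ⋅ y); rewrite ?homM.
- by move=> _ [x _ <-]; exists x^†; rewrite ?homS.
Qed.

Fact fprod_face_coprod (D : starAlgType C) (f g : fprod A1 A2 -> D) :
  star_hom_on (range (@fp_inl C A1 A2)) f ->
  star_hom_on (range (@fp_inr C A1 A2)) g ->
  exists! h : fprod A1 A2 -> D,
    [/\ star_hom h, forall a, range (@fp_inl C A1 A2) a -> h a = f a &
        forall a, range (@fp_inr C A1 A2) a -> h a = g a].
Proof.
move=> [fP fM fS] [gP gM gS].
have hl := fp_inl_hom A1 A2; have hr := fp_inr_hom A1 A2.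
have fh : star_hom (f \o @fp_inl C A1 A2).
  split=> [a x y _ _|x y _ _|x _] /=.
  - by rewrite (homP hl) fP //; exists x || exists y.
  - by rewrite (homM hl) fM //; exists x || exists y.
  - by rewrite (homS hl) fS //; exists x.
have gh : star_hom (g \o @fp_inr C A1 A2).
  split=> [a x y _ _|x y _ _|x _] /=.
  - by rewrite (homP hr) gP //; exists x || exists y.
  - by rewrite (homM hr) gM //; exists x || exists y.
  - by rewrite (homS hr) gS //; exists x.
exists (fp_lift (f \o @fp_inl C A1 A2) (g \o @fp_inr C A1 A2)); split.
  split; first exact: fp_lift_hom.
    by move=> _ [a _ <-]; rewrite fp_lift_inl.
  by move=> _ [a _ <-]; rewrite fp_lift_inr.
move=> h [hh h1 h2]; apply/funext => x; apply/esym/fp_lift_unique => // a.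
  by rewrite h1 //; exists a.
by rewrite h2 //; exists a.
Qed.

Definition fprod_twoFaced : twoFaced C :=
  TwoFaced (range_subalgebra (fp_inl_hom A1 A2))
    (range_subalgebra (fp_inr_hom A1 A2)) fprod_face_coprod.
End TwoFacedCoproduct.

Section Subalgebra.
Variables (C : numClosedFieldType) (A : starAlgType C) (S : set A).
Hypothesis hS : star_subalgebra S.

Definition subalg_of (h : star_subalgebra S) := {x : A | S x}.
Local Notation sub := (subalg_of hS).
HB.instance Definition _ := gen_eqMixin sub.
HB.instance Definition _ := gen_choiceMixin sub.

Let sv (x : sub) : A := projT1 x.
Lemma subalg_inj (x y : sub) : projT1 x = projT1 y -> x = y.
Proof.
case: x y => [x p] [y q] /= e; subst y.
by congr exist; apply: Prop_irrelevance.
Qed.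
Let S0 : S 0. Proof. by case: hS. Qed.
Let SP a x y : S x -> S y -> S (a *: x + y). Proof. by case: hS => _ h _ _; apply: h. Qed.
Let SM x y : S x -> S y -> S (x ⋅ y). Proof. by case: hS => _ _ h _; apply: h. Qed.
Let SS x : S x -> S x^†. Proof. by case: hS => _ _ _; apply. Qed.
Let SD x y : S x -> S y -> S (x + y).
Proof. by move=> hx hy; rewrite -[x]scale1r; apply: SP. Qed.
Let SZ a x : S x -> S (a *: x).
Proof. by move=> hx; rewrite -[a *: x]addr0; apply: SP. Qed.

Definition sub_zero : sub := exist _ 0 S0.
Definition sub_add (x y : sub) : sub := exist _ _ (SD (projT2 x) (projT2 y)).
Definition sub_scale a (x : sub) : sub := exist _ _ (SZ a (projT2 x)).
Definition sub_opp (x : sub) : sub := sub_scale (-1) x.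
Definition sub_mul (x y : sub) : sub := exist _ _ (SM (projT2 x) (projT2 y)).
Definition sub_star (x : sub) : sub := exist _ _ (SS (projT2 x)).

Fact sub_addA : associative sub_add.
Proof. by move=> x y z; apply: subalg_inj; apply: addrA. Qed.
Fact sub_addC : commutative sub_add.
Proof. by move=> x y; apply: subalg_inj; apply: addrC. Qed.
Fact sub_add0 : left_id sub_zero sub_add.
Proof. by move=> x; apply: subalg_inj; apply: add0r. Qed.
Fact sub_addN : left_inverse sub_zero sub_opp sub_add.
Proof.
move=> x; apply: subalg_inj; rewrite -[LHS]/(-1 *: sv x + sv x).
by rewrite scaleN1r addNr.
Qed.
HB.instance Definition _ :=
  GRing.isZmodule.Build sub sub_addA sub_addC sub_add0 sub_addN.
Fact sub_scaleA a b x : sub_scale a (sub_scale b x) = sub_scale (a * b) x.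
Proof. by apply: subalg_inj; apply: scalerA. Qed.
Fact sub_scale1 : left_id 1 sub_scale.
Proof. by move=> x; apply: subalg_inj; apply: scale1r. Qed.
Fact sub_scaleDr : right_distributive sub_scale +%R.
Proof. by move=> a x y; apply: subalg_inj; apply: scalerDr. Qed.
Fact sub_scaleDl x : {morph sub_scale^~ x : a b / a + b}.
Proof. by move=> a b; apply: subalg_inj; apply: scalerDl. Qed.
HB.instance Definition _ := GRing.Zmodule_isLmodule.Build C sub
  sub_scaleA sub_scale1 sub_scaleDr sub_scaleDl.
Fact sub_mulA x y z : sub_mul x (sub_mul y z) = sub_mul (sub_mul x y) z.
Proof. by apply: subalg_inj; apply: smulA. Qed.
Fact sub_mulPl a x y z :
  sub_mul (a *: x + y) z = a *: sub_mul x z + sub_mul y z.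
Proof. by apply: subalg_inj; apply: smulPl. Qed.
Fact sub_mulPr a x y z :
  sub_mul x (a *: y + z) = a *: sub_mul x y + sub_mul x z.
Proof. by apply: subalg_inj; apply: smulPr. Qed.
Fact sub_starP a x y : sub_star (a *: x + y) = a^* *: sub_star x + sub_star y.
Proof. by apply: subalg_inj; apply: starP. Qed.
Fact sub_starM x y : sub_star (sub_mul x y) = sub_mul (sub_star y) (sub_star x).
Proof. by apply: subalg_inj; apply: starM. Qed.
Fact sub_starK x : sub_star (sub_star x) = x.
Proof. by apply: subalg_inj; apply: starK. Qed.
HB.instance Definition _ := isStarAlgebra.Build C sub
  sub_mulA sub_mulPl sub_mulPr sub_starP sub_starM sub_starK.

Definition sub_val (x : sub) : A := sv x.
Lemma sub_val_hom : star_hom sub_val. Proof. by []. Qed.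
Lemma sub_valP x : S (sub_val x). Proof. exact: (projT2 x). Qed.
End Subalgebra.

(* A two-faced *-algebra is generated by its faces. *)
Lemma twoFaced_gen (C : numClosedFieldType) (A : twoFaced C) (S : set A) :
  star_subalgebra S -> (forall a, face1 A a -> S a) ->
  (forall a, face2 A a -> S a) -> forall a, S a.
Proof.
move=> hS h1 h2 a0.
pose r (x : A) : subalg_of hS :=
  if pselect (S x) is left p then exist _ x p else 0.
have rv x : S x -> sub_val (r x) = x.
  by rewrite /r /sub_val; case: pselect => // p _.
have rh F : F `<=` S -> star_subalgebra F -> star_hom_on F r.
  move=> FS [_ FP FM Fs]; have vi (x y : subalg_of hS) : sub_val x = sub_val y -> x = y.
    exact: subalg_inj.
  split=> [a x y Fx Fy|x y Fx Fy|x Fx]; apply: vi.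
  - rewrite rv; last by apply/FS/FP.
    by rewrite (homP (sub_val_hom hS)) !rv //; apply: FS.
  - rewrite rv; last by apply/FS/FM.
    by rewrite (homM (sub_val_hom hS)) !rv //; apply: FS.
  - rewrite rv; last by apply/FS/Fs.
    by rewrite (homS (sub_val_hom hS)) !rv //; apply: FS.
have [h [[hh r1 r2] _]] := face_coprod (rh _ h1 (face1_sub A)) (rh _ h2 (face2_sub A)).
have ih (F : set A) : star_hom_on F (@idfun A) by [].
have [k [_ ku]] := face_coprod (ih (face1 A)) (ih (face2 A)).
have e : idfun = @sub_val _ _ _ hS \o h.
  transitivity k; first by apply/esym/ku.
  apply: ku; split; first by apply: star_hom_comp => //; apply: sub_val_hom.
    by move=> a fa; rewrite /= r1 // rv //; apply: h1.
  by move=> a fa; rewrite /= r2 // rv //; apply: h2.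
by rewrite -[a0]/(idfun a0) e; apply: sub_valP.
Qed.

Lemma fprod_gen (C : numClosedFieldType) (A B : starAlgType C)
    (S : set (fprod A B)) :
  star_subalgebra S -> (forall a, S (fp_inl B a)) -> (forall b, S (fp_inr A b)) ->
  forall c, S c.
Proof.
move=> hS hA hB.
apply: (@twoFaced_gen _ (fprod_twoFaced A B)) => // _ [a _ <-] //.
Qed.

Section Intertwine.
Variables (C : numClosedFieldType) (H K : preHilbertType C) (V : H -> K).

Definition vac_isometry : Prop :=
  [/\ forall a x y, V (a *: x + y) = a *: V x + V y,
      forall x y, ⟨V x, V y⟩ = ⟨x, y⟩ & V Ω = Ω].

Definition intertwines (X : adjop H) (Y : adjop K) : Prop :=
  (forall x, V (X x) = Y (V x)) /\ (forall x, V (opadj X x) = opadj Y (V x)).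

Hypothesis hV : vac_isometry.
Let VP a x y : V (a *: x + y) = a *: V x + V y. Proof. by case: hV. Qed.
Let V0 : V 0 = 0.
Proof.
have := VP 1 0 0; rewrite !scale1r addr0 => /eqP.
by rewrite -subr_eq subrr => /eqP <-.
Qed.
Let VZ a x : V (a *: x) = a *: V x.
Proof. by rewrite -[a *: x]addr0 VP V0 addr0. Qed.

Lemma intertwinesP a X X' Y Y' : intertwines X Y -> intertwines X' Y' ->
  intertwines (a *: X + X') (a *: Y + Y').
Proof.
move=> [h1 h2] [h1' h2']; split=> x.
  by rewrite [LHS]VP h1 h1'.
by rewrite [LHS]VP h2 h2'.
Qed.
Lemma intertwinesM X X' Y Y' : intertwines X Y -> intertwines X' Y' ->
  intertwines (X ⋅ X') (Y ⋅ Y').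
Proof.
move=> [h1 h2] [h1' h2']; split=> x.
  by rewrite [LHS]h1 h1'.
by rewrite [LHS]h2' h2.
Qed.
Lemma intertwinesS X Y : intertwines X Y -> intertwines X^† Y^†.
Proof. by case. Qed.
Lemma intertwines0 : intertwines 0 0.
Proof. by split=> x; apply: V0. Qed.
Lemma intertwinesD X X' Y Y' : intertwines X Y -> intertwines X' Y' ->
  intertwines (X + X') (Y + Y').
Proof.
by move=> h h'; have := intertwinesP 1 h h'; rewrite !scale1r.
Qed.
Lemma intertwinesZ a X Y : intertwines X Y -> intertwines (a *: X) (a *: Y).
Proof.
by move=> h; rewrite -[_ *: X]addr0 -[_ *: Y]addr0; apply: intertwinesP intertwines0.
Qed.
Let vacE x : ⟨Ω, V x⟩ = ⟨Ω, x⟩.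
Proof. by case: hV => _ h e; rewrite -{1}e h. Qed.
Lemma intertwines_vac : intertwines (proj_vac H) (proj_vac K).
Proof.
have e x : V (proj_vac H x) = proj_vac K (V x).
  rewrite -[proj_vac H x]/(⟨Ω, x⟩ *: Ω) VZ.
  by rewrite -[RHS]/(⟨Ω, V x⟩ *: Ω) vacE; case: hV => _ _ ->.
by split; apply: e.
Qed.
Lemma intertwines_perp : intertwines (proj_perp H) (proj_perp K).
Proof.
have e x : V (proj_perp H x) = proj_perp K (V x).
  rewrite !proj_perpE addrC -scaleNr VP vacE scaleNr addrC.
  by case: hV => _ _ ->.
by split; apply: e.
Qed.
Lemma intertwines_twist γ X Y :
  intertwines X Y -> intertwines (twist γ X) (twist γ Y).
Proof.
move=> h; rewrite !twistE.
have [p q] := (intertwines_vac, intertwines_perp).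
by do !(apply: intertwinesD || apply: intertwinesZ || apply: intertwinesM).
Qed.
End Intertwine.

Section IntertwineTensor.
Variables (C : numClosedFieldType) (H K G L : preHilbertType C).
Variables (V : H -> K) (W : G -> L).
Hypotheses (hV : vac_isometry V) (hW : vac_isometry W).

Let f x y : tens K L := tpure (V x) (W y).
Let f_bil : bilinear_map f.
Proof.
case: hV hW => VP _ _ [WP _ _].
split=> a u v w; rewrite /f ?VP ?WP; first exact: (tpure_bilinear _ _).1.
exact: (tpure_bilinear _ _).2.
Qed.
Definition tens_map : tens H G -> tens K L := tens_lift f.
Lemma tens_map_pure x y : tens_map (tpure x y) = tpure (V x) (W y).
Proof. exact: (tens_lift_pure f_bil). Qed.

Lemma tens_map_isometry : vac_isometry tens_map.
Proof.
split; first by move=> *; apply: (tens_liftP f_bil).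
  move=> t u; elim/tens_ind: t => [|x y t IH].
    by rewrite /tens_map (tens_lift0 f_bil) !inner0l.
  rewrite /tens_map (tens_liftD f_bil) !innerDl IH; congr (_ + _).
  elim/tens_ind: u {IH} => [|x' y' u IH].
    by rewrite (tens_lift0 f_bil) !inner0r.
  rewrite (tens_liftD f_bil) !innerDr IH; congr (_ + _).
  rewrite !(tens_lift_pure f_bil) !inner_pure.
  by case: hV hW => _ -> _ [_ -> _].
by rewrite tens_map_pure; case: hV hW => _ _ -> [_ _ ->].
Qed.

Lemma intertwines_tens X X' Y Y' : intertwines V X X' -> intertwines W Y Y' ->
  intertwines tens_map (tens_op X Y) (tens_op X' Y').
Proof.
have aux (X0 : adjop H) (X0' : adjop K) (Y0 : adjop G) (Y0' : adjop L) : (forall x, V (X0 x) = X0' (V x)) ->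
    (forall y, W (Y0 y) = Y0' (W y)) ->
    forall t, tens_map (tens_op X0 Y0 t) = tens_op X0' Y0' (tens_map t).
  move=> h k; elim/tens_ind => [|x y t IH].
    by rewrite op0 /tens_map (tens_lift0 f_bil) op0.
  rewrite opD /tens_map !(tens_liftD f_bil) opD; congr (_ + _) => //.
  by rewrite tens_op_pure !(tens_lift_pure f_bil) tens_op_pure /f h k.
move=> [h1 h2] [k1 k2]; split; first exact: aux.
exact: (aux (op_star X) (op_star X') (op_star Y) (op_star Y')).
Qed.

Lemma intertwines_left γ X X' : intertwines V X X' ->
  intertwines tens_map (lift_left G γ X) (lift_left L γ X').
Proof.
move=> h; apply: (intertwinesD tens_map_isometry); apply: intertwines_tens => //.
- exact: intertwines_vac.
- exact: intertwines_twist.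
- exact: intertwines_perp.
Qed.
Lemma intertwines_right γ Y Y' : intertwines W Y Y' ->
  intertwines tens_map (lift_right H γ Y) (lift_right K γ Y').
Proof.
move=> h; apply: (intertwinesD tens_map_isometry); apply: intertwines_tens => //.
- exact: intertwines_vac.
- exact: intertwines_perp.
- exact: intertwines_twist.
Qed.
End IntertwineTensor.

Section GNSUniversal.
Variables (C : numClosedFieldType) (A : starAlgType C) (φ : state A).
Variables (H : preHilbertType C) (π : A -> adjop H).
Hypothesis hπ : represents φ π.

Let v (x : unitization A) : H := x.1 *: Ω + π x.2 Ω.
Let vP a x y : v (a *: x + y) = a *: v x + v y.
Proof.
case: hπ => πh _; rewrite /v (homP πh).
rewrite -[(_ + _).1]/(a * x.1 + y.1) -[opfun _ Ω]/(a *: π x.2 Ω + π y.2 Ω).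
by rewrite scalerDl scalerDr scalerA addrACA.
Qed.
Let v_form x y : ⟨v x, v y⟩ = gns_form φ x y.
Proof.
case: hπ => πh e.
rewrite /gns_form /unital_ext /= e !(homD πh) !(homZ πh) (homM πh) (homS πh).
rewrite -[opfun (_ + _ + _) Ω]/(x.1^* *: π y.2 Ω + y.1 *: opadj (π x.2) Ω
  + opadj (π x.2) (π y.2 Ω)).
rewrite /v innerDl !innerDr !innerZl !innerZr inner_vacuum -!opadjP.
by ring.
Qed.
Definition gns_map (x : gns φ) : H := v (repr x).
Let gns_map_pi x : gns_map (\pi_(gns φ) x) = v x.
Proof.
have hy z : gns_form φ z (repr (\pi_(gns φ) x)) = gns_form φ z x.
  have /eqmodP/asboolP : repr (\pi_(gns φ) x) = x %[mod gns φ] by rewrite reprK.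
  exact.
apply/eqP; rewrite -subr_eq0; apply/eqP/inner_eq0; rewrite /gns_map.
rewrite addrC -scaleN1r -vP v_form gns_formPr hy mulN1r.
exact: addNr.
Qed.

Lemma gns_map_isometry : vac_isometry gns_map.
Proof.
have hi x y : ⟨gns_map x, gns_map y⟩ = ⟨x, y⟩ by apply: v_form.
split=> //; last first.
  rewrite -[Ω in LHS]/(\pi_(gns φ) (1, 0)) gns_map_pi.
  case: hπ => πh _; rewrite /v scale1r -[_.2]/(0 : A) (hom0 πh).
  exact: addr0.
move=> a x y; apply/eqP; rewrite -subr_eq0; apply/eqP/inner_eq0.
set d := _ - _.
have z0 z : ⟨gns_map z, d⟩ = 0.
  by rewrite /d innerBr hi [X in _ - X]innerPr !hi innerPr subrr.
by rewrite {1}/d innerBl z0 [X in _ - X]innerDl innerZl !z0 mulr0 addr0 subrr.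
Qed.

Lemma gns_map_intertwines a : intertwines gns_map (gns_rep φ a) (π a).
Proof.
case: hπ => πh _.
have e b x : gns_map (gns_rep φ b x) = π b (gns_map x).
  rewrite [LHS]gns_map_pi /gns_map /v /= mul0r !scale0r !add0r.
  rewrite (homD πh) (homZ πh) (homM πh) opD opZ.
  by [].
split=> x; first exact: e.
by rewrite [LHS](e a^†) (homS πh).
Qed.
End GNSUniversal.

(* Tprod does not depend on the choice of the representations. *)
Section Independence.
Variables (C : numClosedFieldType) (γ1 δ1 γ2 δ2 : C).
Hypotheses (hγ1 : `|γ1| = 1 \/ γ1 = 0) (hδ1 : `|δ1| = 1 \/ δ1 = 0).
Hypotheses (hγ2 : `|γ2| = 1 \/ γ2 = 0) (hδ2 : `|δ2| = 1 \/ δ2 = 0).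

Lemma TprodE (A B : twoFaced C) (φ : state A) (ψ : state B)
    (H G : preHilbertType C) (π : A -> adjop H) (σ : B -> adjop G)
    (Π : fprod A B -> adjop (tens H G)) :
  represents φ π -> represents ψ σ -> is_joint_rep γ1 δ1 γ2 δ2 π σ Π ->
  forall c, Tprod γ1 δ1 γ2 δ2 φ ψ c = ⟨Ω, Π c Ω⟩.
Proof.
move=> hπ hσ [Πh Πa1 Πa2 Πb1 Πb2] c.
have hV := gns_map_isometry hπ; have hW := gns_map_isometry hσ.
have hVW := tens_map_isometry hV hW.
have [Jh Ja1 Ja2 Jb1 Jb2] := joint_repP hγ1 hδ1 hγ2 hδ2
  (gns_represents φ).1 (gns_represents ψ).1.
set J := joint_rep _ _ _ _ _ _ in Jh Ja1 Ja2 Jb1 Jb2.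
pose U := tens_map (@gns_map _ _ φ _ π) (@gns_map _ _ ψ _ σ).
pose S := [set c | intertwines U (J c) (Π c)].
have hS : star_subalgebra S.
  split; rewrite /S /=.
  - by rewrite (hom0 Jh) (hom0 Πh); apply: intertwines0.
  - by move=> a x y hx hy; rewrite (homP Jh) (homP Πh); apply: intertwinesP.
  - by move=> x y hx hy; rewrite (homM Jh) (homM Πh); apply: intertwinesM.
  - by move=> x hx; rewrite (homS Jh) (homS Πh); apply: intertwinesS.
have pre (D : starAlgType C) (i : D -> fprod A B) :
    star_hom i -> star_subalgebra [set a | S (i a)].
  move=> ih; case: hS => s0 sP sM sS; split=> /=.
  - by rewrite (hom0 ih).
  - by move=> a x y hx hy; rewrite (homP ih); apply: sP.
  - by move=> x y hx hy; rewrite (homM ih); apply: sM.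
  - by move=> x hx; rewrite (homS ih); apply: sS.
have hA : forall a, S (fp_inl B a).
  apply: (twoFaced_gen (pre _ _ (fp_inl_hom A B))) => a ha; rewrite /S /=.
    rewrite Ja1 // Πa1 //; apply: intertwines_left => //.
    exact: gns_map_intertwines.
  rewrite Ja2 // Πa2 //; apply: intertwines_left => //.
  exact: gns_map_intertwines.
have hB : forall b, S (fp_inr A b).
  apply: (twoFaced_gen (pre _ _ (fp_inr_hom A B))) => b hb; rewrite /S /=.
    rewrite Jb1 // Πb1 //; apply: intertwines_right => //.
    exact: gns_map_intertwines.
  rewrite Jb2 // Πb2 //; apply: intertwines_right => //.
  exact: gns_map_intertwines.
have [h _] : S c by apply: fprod_gen.
rewrite -[LHS]/⟨Ω, J c Ω⟩.
case: hVW => _ hi e; rewrite -[LHS]hi -/U h.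
by rewrite -/U in e; rewrite e.
Qed.
End Independence.

Section Symmetry.
Variable C : numClosedFieldType.

Definition state_product : Type :=
  forall A B : twoFaced C, state A -> state B -> state (fprod A B).

(* Θ_{A,B} : A ⊔ B → B ⊔ A *)
Definition fprod_swap (A B : starAlgType C) : fprod A B -> fprod B A :=
  fp_lift (@fp_inr C B A) (@fp_inl C B A).

Definition symmetric_product (P : state_product) : Prop :=
  forall (A B : twoFaced C) (φ : state A) (ψ : state B) (c : fprod A B),
    P A B φ ψ c = P B A ψ φ (fprod_swap c).

Definition circle : set C := [set z | `|z| = 1].

Definition J_tens : set (C * C) :=
  [set p | (circle p.1 \/ p.1 = 0) /\ (circle p.2 \/ p.2 = 0) /\
           [\/ p.1 = p.2, p.1 = 0 | p.2 = 0]].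
End Symmetry.

(* Main.v *)
(** When γ_i = δ_i, the flip H ⊗ G → G ⊗ H exchanges the left and right lifts,
so the product is symmetric.  Conversely, if φ(a) = 0, φ(a²) = 1 and b acts as
the identity, then a b a has expectation |δ_i| for φ ⊙ ψ and |γ_i| for ψ ⊙ φ when
a and b lie in face i; on J_⊗ the equality |γ_i| = |δ_i| forces γ_i = δ_i.
Multiplying all four parameters by one α of modulus 1 leaves the product
unchanged, because the unitary that is α on Ĥ ⊗ Ĝ and the identity on the
complement fixes Ω and conjugates λ^γ into λ^(αγ) and ρ^δ into ρ^(αδ); this
normalises a pair of nonzero parameters to (ζ, 1). *)

From HB Require Import structures.
From mathcomp Require Import all_boot all_order all_algebra.
From mathcomp Require Import complex.
From mathcomp Require Import boolp classical_sets reals.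
Require Import Defs.

Set Implicit Arguments.
Unset Strict Implicit.
Unset Printing Implicit Defensive.

Import GRing.Theory Num.Theory.
Local Open Scope ring_scope.
Local Open Scope classical_set_scope.

(** * Intertwiners between representations of a coproduct *)

Section IntertwineJoint.
Context {C : numClosedFieldType} {A B : twoFaced C} {K L : preHilbertType C}.
Variables (V : K -> L) (Π : fprod A B -> adjop K) (Π' : fprod A B -> adjop L).
Hypotheses (hV : vac_isometry V) (Πh : star_hom Π) (Πh' : star_hom Π').
Hypotheses
  (hA1 : forall a, face1 A a -> intertwines V (Π (fp_inl B a)) (Π' (fp_inl B a)))
  (hA2 : forall a, face2 A a -> intertwines V (Π (fp_inl B a)) (Π' (fp_inl B a)))
  (hB1 : forall b, face1 B b -> intertwines V (Π (fp_inr A b)) (Π' (fp_inr A b)))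
  (hB2 : forall b, face2 B b -> intertwines V (Π (fp_inr A b)) (Π' (fp_inr A b))).

(** The elements on which [V] intertwines form a *-subalgebra, and the faces of [A] and [B] together
    generate the coproduct. *)
Lemma intertwines_fprod c : intertwines V (Π c) (Π' c).
Proof.
(* Stating this along an arbitrary homomorphism [i] covers the coproduct itself ([i = id]) and each
   factor ([i] an inclusion). *)
have hS (D : starAlgType C) (i : D -> fprod A B) : star_hom i ->
    star_subalgebra [set d | intertwines V (Π (i d)) (Π' (i d))].
  move=> ih; split=> /= [|a x y hx hy|x y hx hy|x hx].
  - by rewrite (hom0 ih) (hom0 Πh) (hom0 Πh'); apply: intertwines0.
  - by rewrite (homP ih) (homP Πh) (homP Πh'); apply: intertwinesP.
  - by rewrite (homM ih) (homM Πh) (homM Πh'); apply: intertwinesM.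
  - by rewrite (homS ih) (homS Πh) (homS Πh'); apply: intertwinesS.
apply: (fprod_gen (hS _ id _)) => // [a|b].
  exact: (twoFaced_gen (hS _ _ (fp_inl_hom A B))).
exact: (twoFaced_gen (hS _ _ (fp_inr_hom A B))).
Qed.

(** An isometric intertwiner fixing the vacuum preserves vacuum expectations; both the symmetry and
    the rescaling of the product come down to this. *)
Lemma vacuum_fprod c : inner Ω (Π c Ω) = inner Ω (Π' c Ω).
Proof.
have [h _] := intertwines_fprod c; have [_ Vi VΩ] := hV.
by rewrite -Vi h VΩ.
Qed.
End IntertwineJoint.

(** * The tensor flip and symmetry for equal left and right parameters *)

Section Flip.
Context {C : numClosedFieldType}.

Definition tens_flip (H G : preHilbertType C) : tens H G -> tens G H :=
  tens_lift (fun x y => tpure y x).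
Arguments tens_flip : clear implicits.

Section FlipTheory.
Context {H G : preHilbertType C}.

Let flip_bil : bilinear_map (fun (x : H) (y : G) => tpure y x).
Proof.
split=> a u v w; first exact: (tpure_bilinear _ _).2.
exact: (tpure_bilinear _ _).1.
Qed.

Lemma tens_flip_pure x y : tens_flip H G (tpure x y) = tpure y x.
Proof. exact: tens_lift_pure. Qed.

Lemma tens_flip_isometry : vac_isometry (tens_flip H G).
Proof.
split=> [a x y|t u|]; [exact: tens_liftP| |exact: tens_flip_pure].
elim/tens_ind: t => [|x y t IH].
  by rewrite /tens_flip tens_lift0 // !inner0l.
rewrite /tens_flip tens_liftD // !innerDl IH; congr (_ + _).
elim/tens_ind: u {IH} => [|x' y' u IH]; first by rewrite tens_lift0 // !inner0r.
by rewrite tens_liftD // !innerDr IH !tens_lift_pure // !inner_pure mulrC.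
Qed.

Lemma intertwines_flip (X : adjop H) (Y : adjop G) :
  intertwines (tens_flip H G) (tens_op X Y) (tens_op Y X).
Proof.
have aux (X0 : adjop H) (Y0 : adjop G) t :
    tens_flip H G (tens_op X0 Y0 t) = tens_op Y0 X0 (tens_flip H G t).
  elim/tens_ind: t => [|x y t IH]; first by rewrite op0 /tens_flip tens_lift0 // op0.
  rewrite opD /tens_flip !tens_liftD // opD; congr (_ + _) => //.
  by rewrite tens_op_pure !tens_lift_pure // tens_op_pure.
by split; [apply: aux|apply: (aux (op_star X) (op_star Y))].
Qed.

Lemma intertwines_flip_left γ (X : adjop H) :
  intertwines (tens_flip H G) (lift_left G γ X) (lift_right G γ X).
Proof. by apply: (intertwinesD tens_flip_isometry); apply: intertwines_flip. Qed.

Lemma intertwines_flip_right δ (Y : adjop G) :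
  intertwines (tens_flip H G) (lift_right H δ Y) (lift_left H δ Y).
Proof. by apply: (intertwinesD tens_flip_isometry); apply: intertwines_flip. Qed.
End FlipTheory.

(** The flip intertwines the joint representation for φ ⊙ ψ with the one for ψ ⊙ φ composed with Θ,
    because it carries λ^γ to ρ^γ and back. *)
Lemma Tprod_symmetric (γ1 γ2 : C) :
  `|γ1| = 1 \/ γ1 = 0 -> `|γ2| = 1 \/ γ2 = 0 ->
  symmetric_product (Tprod γ1 γ1 γ2 γ2).
Proof.
move=> h1 h2 A B φ ψ c.
have [φh _] := gns_represents φ; have [ψh _] := gns_represents ψ.
have [Jh Ja1 Ja2 Jb1 Jb2] := joint_repP h1 h1 h2 h2 φh ψh.
(* Here [B] is the left factor, so the clauses for [B] come first and [A] acts by right lifts. *)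
have [Kh Kb1 Kb2 Ka1 Ka2] := joint_repP h1 h1 h2 h2 ψh φh.
have rh := fp_inr_hom B A; have lh := fp_inl_hom B A.
have Θh : star_hom (@fprod_swap C A B) by apply: fp_lift_hom.
have Θl (a : A) : fprod_swap (fp_inl B a) = fp_inr B a by exact: (fp_lift_inl rh lh).
have Θr (b : B) : fprod_swap (fp_inr A b) = fp_inl A b by exact: (fp_lift_inr rh lh).
apply: (vacuum_fprod (Π' := _ \o @fprod_swap C A B)
  tens_flip_isometry Jh (star_hom_comp Θh Kh)) => x hx /=.
- by rewrite Θl Ja1 // Ka1 //; apply: intertwines_flip_left.
- by rewrite Θl Ja2 // Ka2 //; apply: intertwines_flip_left.
- by rewrite Θr Jb1 // Kb1 //; apply: intertwines_flip_right.
- by rewrite Θr Jb2 // Kb2 //; apply: intertwines_flip_right.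
Qed.
End Flip.

(** * Invariance under a common phase *)

Section Rescale.
Context {C : numClosedFieldType}.

Lemma phase_mul (α γ : C) :
  `|α| = 1 -> `|γ| = 1 \/ γ = 0 -> `|α * γ| = 1 \/ α * γ = 0.
Proof.
by move=> α1 [γ1|->]; [left; rewrite normrM α1 γ1 mulr1|right; rewrite mulr0].
Qed.

(** The four blocks are scaled by |γ|, γ, its conjugate and |γ|, and each of these factors is
    multiplicative in γ. *)
Lemma twist_twist (H : preHilbertType C) (α γ : C) (X : adjop H) : `|α| = 1 ->
  twist α (twist γ X) = twist (α * γ) X.
Proof.
move=> α1; rewrite [in LHS]twistE [in RHS]twistE twistE.
rewrite !(smulDr, smulDl, smulZl, smulZr) !smulA.
rewrite !(proj_vac2, proj_perp2, proj_vac_perp, proj_perp_vac0, smul0l).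
rewrite -!smulA !(proj_vac2, proj_perp2, proj_vac_perp, proj_perp_vac0, smul0r).
rewrite !(scaler0, addr0, add0r) !scalerA α1 normrM α1 !mul1r rmorphM scale1r.
by rewrite scalerDr.
Qed.

(** Twisting by a unimodular α is conjugation by [op_phase α], whose adjoint is then cancelled. *)
Lemma twist_op_phase (H : preHilbertType C) (α γ : C) (X : adjop H) : `|α| = 1 ->
  smul (twist (α * γ) X) (op_phase H α) = smul (op_phase H α) (twist γ X).
Proof.
move=> α1; rewrite -twist_twist // twist_phase // -smulA op_phaseK //.
exact: op_idr.
Qed.

Section TensPhase.
Variables (H G : preHilbertType C) (α : C).
Hypothesis α1 : `|α| = 1.

(* Multiplication by α on Ĥ ⊗ Ĝ, the identity on the other three summands. *)
Definition tens_phase : adjop (tens H G) :=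
  tens_op (op_id H) (proj_vac G) + tens_op (op_phase H α) (proj_perp G).

(** The definition is block diagonal in the second leg, as left lifts are; this form is block
    diagonal in the first leg, as right lifts are. *)
Lemma tens_phaseE : tens_phase =
  tens_op (proj_vac H) (op_id G) + tens_op (proj_perp H) (op_phase G α).
Proof.
apply: tens_op_ext => x y.
rewrite -[LHS]/(tens_op _ _ _ + tens_op _ _ _).
rewrite -[RHS]/(tens_op _ _ _ + tens_op _ _ _) !tens_op_pure.
rewrite -[op_id _ _]/x -[op_id _ _]/y.
rewrite -[op_phase H α x]/(proj_vac H x + α *: proj_perp H x).
rewrite -[op_phase G α y]/(proj_vac G y + α *: proj_perp G y).
have dec (K : preHilbertType C) (z : K) : z = proj_vac K z + proj_perp K z.
  by rewrite proj_perpE addrC subrK.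
have -> : tpure x (proj_vac G y) =
    tpure (proj_vac H x) (proj_vac G y) + tpure (proj_perp H x) (proj_vac G y).
  by rewrite -tpureDl -dec.
have -> : tpure (proj_vac H x) y =
    tpure (proj_vac H x) (proj_vac G y) + tpure (proj_vac H x) (proj_perp G y).
  by rewrite -tpureDr -dec.
move: (proj_vac H x) (proj_perp H x) (proj_vac G y) (proj_perp G y) => p q r s.
by rewrite tpureDl tpureDr tpureZl tpureZr -!addrA; congr (_ + _); rewrite addrCA.
Qed.

(** V*V is the identity on both blocks of the second leg, since [op_phase α] is isometric. *)
Lemma tens_phase_isometry : vac_isometry tens_phase.
Proof.
split=> [a x y|x y|]; first exact: opP.
  have -> : inner (tens_phase x) (tens_phase y) =
      inner x (smul (star tens_phase) tens_phase y) by rewrite opadjP.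
  suff -> : smul (star tens_phase) tens_phase = op_id _ by [].
  rewrite /tens_phase starD -!tens_op_star proj_vac_star proj_perp_star.
  rewrite !smulDl !smulDr -!tens_opM proj_vac2 proj_perp2 proj_vac_perp.
  rewrite proj_perp_vac0 !tens_op0r addr0 add0r op_phaseK // op_idr.
  apply: tens_op_ext => u v; rewrite -[LHS]/(tens_op _ _ _ + tens_op _ _ _).
  rewrite !tens_op_pure -tpureDr.
  by rewrite -[proj_perp G v]/(v - proj_vac G v) addrC subrK.
rewrite -[LHS]/(tens_op _ _ _ + tens_op _ _ _) !tens_op_pure proj_perp_vac.
by rewrite tpure0r addr0 -[proj_vac G Ω]/(inner Ω Ω *: Ω) inner_vacuum scale1r.
Qed.

(** On the vacuum block of the second leg both lifts act as [X]; on its complement the claim is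
    [twist_op_phase]. The adjoint half is the same identity for the adjoint of [X]. *)
Lemma intertwines_phase_left γ (X : adjop H) : `|γ| = 1 \/ γ = 0 ->
  intertwines tens_phase (lift_left G γ X) (lift_left G (α * γ) X).
Proof.
move=> hγ.
have eq (Y : adjop H) :
    smul tens_phase (lift_left G γ Y) = smul (lift_left G (α * γ) Y) tens_phase.
  rewrite /tens_phase /lift_left !smulDl !smulDr -!tens_opM.
  rewrite proj_vac2 proj_perp2 proj_vac_perp proj_perp_vac0 !tens_op0r.
  by rewrite op_idl op_idr !addr0 !add0r twist_op_phase.
have adjE β (hβ : `|β| = 1 \/ β = 0) x :
    opadj (lift_left G β X) x = lift_left G β (star X) x.
  by rewrite (homS (lift_left_hom H G hβ)).
split=> x; first by move/(congr1 (fun T : adjop _ => T x)): (eq X).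
rewrite !adjE //; last exact: phase_mul.
by move/(congr1 (fun T : adjop _ => T x)): (eq (star X)).
Qed.

Lemma intertwines_phase_right δ (Y : adjop G) : `|δ| = 1 \/ δ = 0 ->
  intertwines tens_phase (lift_right H δ Y) (lift_right H (α * δ) Y).
Proof.
move=> hδ.
have eq (Z : adjop G) :
    smul tens_phase (lift_right H δ Z) = smul (lift_right H (α * δ) Z) tens_phase.
  rewrite tens_phaseE /lift_right !smulDl !smulDr -!tens_opM.
  rewrite proj_vac2 proj_perp2 proj_vac_perp proj_perp_vac0 !tens_op0l.
  by rewrite op_idl op_idr !addr0 !add0r twist_op_phase.
have adjE β (hβ : `|β| = 1 \/ β = 0) x :
    opadj (lift_right H β Y) x = lift_right H β (star Y) x.
  by rewrite (homS (lift_right_hom H G hβ)).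
split=> x; first by move/(congr1 (fun T : adjop _ => T x)): (eq Y).
rewrite !adjE //; last exact: phase_mul.
by move/(congr1 (fun T : adjop _ => T x)): (eq (star Y)).
Qed.
End TensPhase.

Lemma state_ext (A : starAlgType C) (φ ψ : state A) : φ =1 ψ -> φ = ψ.
Proof.
case: φ ψ => [f fl fp] [g gl gp] /= /funext e; subst g.
by congr State; apply: Prop_irrelevance.
Qed.

(** The equality is one of products as functions, so that it can be rewritten in an identity
    [P = Tprod ...]. *)
Lemma Tprod_rescale (α γ1 δ1 γ2 δ2 : C) : `|α| = 1 ->
  `|γ1| = 1 \/ γ1 = 0 -> `|δ1| = 1 \/ δ1 = 0 ->
  `|γ2| = 1 \/ γ2 = 0 -> `|δ2| = 1 \/ δ2 = 0 ->
  Tprod γ1 δ1 γ2 δ2 = Tprod (α * γ1) (α * δ1) (α * γ2) (α * δ2).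
Proof.
move=> α1 hγ1 hδ1 hγ2 hδ2.
apply: functional_extensionality_dep => A.
apply: functional_extensionality_dep => B.
apply/funext => φ; apply/funext => ψ; apply: state_ext => c.
have [φh _] := gns_represents φ; have [ψh _] := gns_represents ψ.
have [Jh Ja1 Ja2 Jb1 Jb2] := joint_repP hγ1 hδ1 hγ2 hδ2 φh ψh.
have [Kh Ka1 Ka2 Kb1 Kb2] := joint_repP (phase_mul α1 hγ1) (phase_mul α1 hδ1)
  (phase_mul α1 hγ2) (phase_mul α1 hδ2) φh ψh.
apply: (vacuum_fprod (tens_phase_isometry _ _ α1) Jh Kh) => x hx.
- by rewrite Ja1 // Ka1 //; apply: intertwines_phase_left.
- by rewrite Ja2 // Ka2 //; apply: intertwines_phase_left.
- by rewrite Jb1 // Kb1 //; apply: intertwines_phase_right.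
- by rewrite Jb2 // Kb2 //; apply: intertwines_phase_right.
Qed.
End Rescale.

(** * The space ℂ² with its first basis vector as vacuum *)

Section Qubit.
Context {C : numClosedFieldType}.

Definition qubit : Type := (C^o * C^o)%type.
HB.instance Definition _ := GRing.Lmodule.on qubit.

Definition qubit_inner (x y : qubit) : C := x.1^* * y.1 + x.2^* * y.2.
Definition qubit_vac : qubit := (1, 0).

Fact qubit_innerPr a x y z :
  qubit_inner x (a *: y + z) = a * qubit_inner x y + qubit_inner x z.
Proof.
rewrite /qubit_inner -[(_ + _).1]/(a * y.1 + z.1) -[(_ + _).2]/(a * y.2 + z.2).
by rewrite !mulrDr addrACA; congr (_ + _ + _); rewrite mulrCA.
Qed.
Fact qubit_innerC x y : qubit_inner x y = (qubit_inner y x)^*.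
Proof.
by rewrite /qubit_inner rmorphD !rmorphM /= !conjCK; congr (_ + _); rewrite mulrC.
Qed.
Let qubit_innerE x : qubit_inner x x = `|x.1| ^+ 2 + `|x.2| ^+ 2.
Proof. by rewrite /qubit_inner !normCK; congr (_ + _); rewrite mulrC. Qed.
Fact qubit_inner_ge0 x : 0 <= qubit_inner x x.
Proof. by rewrite qubit_innerE addr_ge0 ?exprn_ge0. Qed.
Fact qubit_inner_eq0 x : qubit_inner x x = 0 -> x = 0.
Proof.
rewrite qubit_innerE => /eqP; rewrite paddr_eq0 ?exprn_ge0 //.
by rewrite !sqrf_eq0 !normr_eq0; case: x => a b /= /andP[/eqP -> /eqP ->].
Qed.
Fact qubit_inner_vac : qubit_inner qubit_vac qubit_vac = 1.
Proof. by rewrite qubit_innerE normr1 normr0 expr1n expr0n addr0. Qed.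
HB.instance Definition _ := isPreHilbert.Build C qubit
  qubit_innerPr qubit_innerC qubit_inner_ge0 qubit_inner_eq0 qubit_inner_vac.

Definition qubit_swap_fun (x : qubit) : qubit := (x.2, x.1).
Fact qubit_swap_adj x y : inner (qubit_swap_fun x) y = inner x (qubit_swap_fun y).
Proof. exact: addrC. Qed.
(** The Pauli matrix σ_x: its square is the identity, and it sends Ω to a unit vector orthogonal to
    Ω. *)
Definition qubit_swap : adjop qubit := AdjOp qubit_swap_adj.
End Qubit.

(** * A mixed moment that detects the moduli of the parameters *)

Section Converse.
Context {C : numClosedFieldType}.

Section Alternating.
Variables (H G : preHilbertType C) (γ δ : C).

Lemma lift_left_vac (X : adjop H) x :
  lift_left G γ X (tpure x Ω) = tpure (X x) Ω.
Proof.
rewrite -[LHS]/(tens_op _ _ _ + tens_op _ _ _) !tens_op_pure proj_perp_vac.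
by rewrite tpure0r addr0 -[proj_vac G Ω]/(inner Ω Ω *: Ω) inner_vacuum scale1r.
Qed.

Lemma lift_right_vac (Y : adjop G) y :
  lift_right H δ Y (tpure Ω y) = tpure Ω (Y y).
Proof.
rewrite -[LHS]/(tens_op _ _ _ + tens_op _ _ _) !tens_op_pure proj_perp_vac.
by rewrite tpure0l addr0 -[proj_vac H Ω]/(inner Ω Ω *: Ω) inner_vacuum scale1r.
Qed.

(** The identity has no off-diagonal blocks, so its twist only sees the modulus of the parameter. *)
Lemma twist_id_vac (K : preHilbertType C) β : twist β (op_id K) Ω = `|β| *: Ω.
Proof.
rewrite -[LHS]/(twist_fun β _ Ω) /twist_fun proj_perp_vac.
rewrite -[opfun (op_id K) 0]/(0 : K) op0.
by rewrite inner_vacuum inner0r !scaler0 !addr0 !mulr1.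
Qed.

Lemma lift_right_id_perp x : inner Ω x = 0 ->
  lift_right H δ (op_id G) (tpure x Ω) = `|δ| *: tpure x Ω.
Proof.
move=> x0; rewrite -[LHS]/(tens_op _ _ _ + tens_op _ _ _) !tens_op_pure.
rewrite -[proj_vac H x]/(inner Ω x *: Ω) proj_perpE x0 scale0r tpure0l add0r.
by rewrite subr0 twist_id_vac tpureZr.
Qed.

Lemma lift_left_id_perp y : inner Ω y = 0 ->
  lift_left G γ (op_id H) (tpure Ω y) = `|γ| *: tpure Ω y.
Proof.
move=> y0; rewrite -[LHS]/(tens_op _ _ _ + tens_op _ _ _) !tens_op_pure.
rewrite -[proj_vac G y]/(inner Ω y *: Ω) proj_perpE y0 scale0r tpure0r add0r.
by rewrite subr0 twist_id_vac tpureZl.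
Qed.
End Alternating.

Let D : starAlgType C := adjop (@qubit C).
(** Both faces are copies of the operator algebra of ℂ² and [π] is the identity on each, so one
    state tests either face. *)
Let A : twoFaced C := fprod_twoFaced D D.
Let π : A -> D := fp_lift id id.
Let πh : star_hom π. Proof. exact: fp_lift_hom. Qed.
Let φ : state A := vacuum_state πh.
Let X : D := qubit_swap.

Let XΩ : inner Ω (X Ω) = 0 :> C.
Proof. by rewrite -[LHS]/(1^* * 0 + 0^* * 1) mulr0 conjC0 mul0r addr0. Qed.

Variables γ1 δ1 γ2 δ2 : C.
Hypotheses (hγ1 : `|γ1| = 1 \/ γ1 = 0) (hδ1 : `|δ1| = 1 \/ δ1 = 0).
Hypotheses (hγ2 : `|γ2| = 1 \/ γ2 = 0) (hδ2 : `|δ2| = 1 \/ δ2 = 0).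
Hypothesis symT : symmetric_product (Tprod γ1 δ1 γ2 δ2).

(** The inclusion [j] selects the face. In the word a b a, the first [a] to act moves the vacuum off
    Ω in its own leg, the lift of the identity then contributes a modulus, and the last [a] returns
    to Ω. Θ exchanges the legs, turning |δ| into |γ|. *)
Let symmetric_norm (Π : fprod A A -> adjop (tens qubit qubit))
    (j : D -> A) γ δ :
  is_joint_rep γ1 δ1 γ2 δ2 π π Π ->
  (forall Y, Π (fp_inl A (j Y)) = lift_left qubit γ Y) ->
  (forall Y, Π (fp_inr A (j Y)) = lift_right qubit δ Y) -> `|γ| = `|δ|.
Proof.
move=> JΠ Πl Πr; have [Πh _ _ _ _] := JΠ.
have rep : represents φ π by [].
(* The operator [op_id] is an ordinary element of the face: for parameter 0 its lift is not the
   identity. *)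
pose a := fp_inl A (j X); pose b := fp_inr A (j (op_id _)).
pose a' := fp_inr A (j X); pose b' := fp_inl A (j (op_id _)).
have := @symT _ _ φ φ (smul a (smul b a)).
have rh := fp_inr_hom A A; have lh := fp_inl_hom A A.
have Θh : star_hom (@fprod_swap C A A) by apply: fp_lift_hom.
have Θa : fprod_swap a = a' by exact: (fp_lift_inl rh lh).
have Θb : fprod_swap b = b' by exact: (fp_lift_inr rh lh).
rewrite !(homM Θh) Θa Θb.
rewrite !(TprodE hγ1 hδ1 hγ2 hδ2 rep rep JΠ) !(homM Πh) /a /b /a' /b' !Πl !Πr.
have E (Y Z : adjop (tens qubit qubit)) : smul Y (smul Z Y) Ω = Y (Z (Y Ω)) by [].
rewrite !E -[Ω]/(tpure Ω Ω) lift_left_vac lift_right_vac.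
rewrite lift_right_id_perp // lift_left_id_perp // !opZ.
rewrite lift_left_vac lift_right_vac -[X (X Ω)]/(Ω : qubit) !innerZr.
by rewrite inner_pure inner_vacuum !mulr1 => ->.
Qed.

Lemma symmetric_Tprod_norm : `|γ1| = `|δ1| /\ `|γ2| = `|δ2|.
Proof.
have JΠ := joint_repP hγ1 hδ1 hγ2 hδ2 πh πh; have [_ Ja1 Ja2 Jb1 Jb2] := JΠ.
have πl Y : π (fp_inl D Y) = Y by exact: fp_lift_inl.
have πr Y : π (fp_inr D Y) = Y by exact: fp_lift_inr.
split.
- apply: (symmetric_norm JΠ (j := fp_inl D)) => Y.
    by rewrite Ja1 ?πl //; exists Y.
  by rewrite Jb1 ?πl //; exists Y.
- apply: (symmetric_norm JΠ (j := @fp_inr C D D)) => Y.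
    by rewrite Ja2 ?πr //; exists Y.
  by rewrite Jb2 ?πr //; exists Y.
Qed.
End Converse.

(** * From moduli to parameters, and the list of symmetric products *)

Lemma J_tens_norm_eq (C : numClosedFieldType) (γ δ : C) :
  J_tens (γ, δ) -> `|γ| = `|δ| -> γ = δ.
Proof.
(* Distinct parameters in [J_tens] include a zero, and equal moduli then make the other one zero
   too. *)
move=> [_ [_ /= [//|->|->]]]; rewrite normr0.
  by move/esym/normr0_eq0.
by move/normr0_eq0.
Qed.

Lemma Tprod_symmetricE (C : numClosedFieldType) (γ1 δ1 γ2 δ2 : C) :
  J_tens (γ1, δ1) -> J_tens (γ2, δ2) ->
  symmetric_product (Tprod γ1 δ1 γ2 δ2) <-> γ1 = δ1 /\ γ2 = δ2.
Proof.
move=> J1 J2; have [hγ1 [hδ1 _]] := J1; have [hγ2 [hδ2 _]] := J2.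
split=> [s|[<- <-]]; last exact: Tprod_symmetric.
have [e1 e2] := symmetric_Tprod_norm hγ1 hδ1 hγ2 hδ2 s.
by split; apply: J_tens_norm_eq.
Qed.

Theorem proposition5p13 (R : realType) :
  (forall γ1 δ1 γ2 δ2 : R[i],
     J_tens (γ1, δ1) -> J_tens (γ2, δ2) ->
     (symmetric_product (Tprod γ1 δ1 γ2 δ2) <-> γ1 = δ1 /\ γ2 = δ2))
  /\
  (forall P : state_product R[i],
     ((exists γ1 δ1 γ2 δ2 : R[i],
         [/\ J_tens (γ1, δ1), J_tens (γ2, δ2) & P = Tprod γ1 δ1 γ2 δ2])
      /\ symmetric_product P)
     <->
     [\/ exists2 ζ : R[i], circle ζ & P = Tprod ζ ζ 1 1,
         P = Tprod 0 0 1 1,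
         P = Tprod 1 1 0 0
       | P = Tprod 0 0 0 0]).
Proof.
split=> [|P]; first exact: Tprod_symmetricE.
have J_diag (γ : R[i]) : `|γ| = 1 \/ γ = 0 -> J_tens (γ, γ).
  by move=> hγ; split=> //; split=> //; apply: Or31.
have in_list (γ δ : R[i]) : `|γ| = 1 \/ γ = 0 -> `|δ| = 1 \/ δ = 0 ->
    P = Tprod γ γ δ δ ->
    (exists γ1 δ1 γ2 δ2 : R[i],
      [/\ J_tens (γ1, δ1), J_tens (γ2, δ2) & P = Tprod γ1 δ1 γ2 δ2])
    /\ symmetric_product P.
  move=> hγ hδ ->; split; last exact: Tprod_symmetric.
  by exists γ, γ, δ, δ; split=> //; apply: J_diag.
have n1 : `|1 : R[i]| = 1 \/ (1 : R[i]) = 0 by left; rewrite normr1.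
split; last first.
  case=> [[ζ hζ]|||]; apply: in_list => //; by [left|right].
case=> [[γ1 [δ1 [γ2 [δ2 [J1 J2 eP]]]]]]; rewrite {1}eP.
move/(Tprod_symmetricE J1 J2) => [e1 e2].
have normV (ζ : R[i]) : `|ζ| = 1 -> `|ζ^-1| = 1 by rewrite normfV => ->; rewrite invr1.
have unitV (ζ : R[i]) : `|ζ| = 1 -> ζ^-1 * ζ = 1.
  by move=> h; rewrite mulVf // -normr_eq0 h oner_eq0.
move: eP; rewrite -e1 -e2 => ->.
have [h1 _] := J1; have [h2 _] := J2; rewrite /= in h1 h2.
case: (h2) => [c2|->].
  (* Rescaling by the inverse of γ2 turns the second pair into (1, 1); the first becomes (ζ, ζ) with
     ζ = γ2⁻¹γ1, or stays (0, 0). *)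
  rewrite (Tprod_rescale (normV _ c2)) //.
  rewrite unitV //; case: h1 => [c1|->]; last by rewrite mulr0; apply: Or42.
  by apply: Or41; exists (γ2^-1 * γ1); rewrite // /circle /= normrM normV // c1 mulr1.
case: h1 => [c1|->]; last exact: Or44.
(* With the second pair zero, the first is normalised to (1, 1) instead. *)
rewrite (Tprod_rescale (normV _ c1)) //; try by [left|right].
by rewrite unitV // mulr0; apply: Or43.
Qed.
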